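(* Every infinite complete Boolean algebra $\mathbb{B}$ has an ultrafilter $\mathcal{U}$ with $(\mathcal{U},\ge)\equiv_T([|\mathbb{B}|]^{<\omega},\subseteq)$.
   Context: For directed partial orders $P,Q$: $P\le_T Q$ (Tukey reducibility) means there is a map $Q\to P$ sending cofinal subsets to cofinal subsets (equivalently, a map $P\to Q$ sending unbounded sets to unbounded sets); $P\equiv_T Q$ means $P\le_T Q$ and $Q\le_T P$. For an ultrafilter $\mathcal{U}$ on a Boolean algebra, $(\mathcal{U},\ge)$ is ordered by the reverse of the Boolean order. $[\kappa]^{<\omega}$ is the set of finite subsets of $\kappa$. *)

(* Defs.v *)
From mathcomp Require Import all_boot all_order finmap.
From mathcomp Require Import all_classical.

Set Implicit Arguments.
Unset Strict Implicit.
Unset Printing Implicit Defensive.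

Import Order.TTheory.

Local Open Scope classical_set_scope.
Local Open Scope order_scope.

Record dirPoset := DirPoset {
  dcarrier :> Type;
  dle : dcarrier -> dcarrier -> Prop;
  dle_refl : forall x, dle x x;
  dle_anti : forall x y, dle x y -> dle y x -> x = y;
  dle_trans : forall x y z, dle x y -> dle y z -> dle x z;
  dle_inh : inhabited dcarrier;
  dle_directed : forall x y, exists z, dle x z /\ dle y z
}.

Definition cofinal (P : dirPoset) (A : set P) :=
  forall p : P, exists2 a, A a & dle p a.

Definition tukey_le (P Q : dirPoset) :=
  exists f : Q -> P, forall A : set Q, cofinal A -> cofinal (f @` A).

Definition tukey_equiv (P Q : dirPoset) := tukey_le P Q /\ tukey_le Q P.

(* Completeness asks for suprema of arbitrary subsets; infima follow. *)
Definition complete_lattice d (L : porderType d) :=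
  forall A : set L, supremums A !=set0.

Record ultrafilter d (B : ctbDistrLatticeType d) := Ultrafilter {
  uf_set : set B;
  uf_top : uf_set \top;
  uf_proper : ~ uf_set \bot;
  uf_meet : forall x y, uf_set x -> uf_set y -> uf_set (x `&` y);
  uf_up : forall x y, x <= y -> uf_set x -> uf_set y;
  uf_ultra : forall x, uf_set x \/ uf_set (~` x)
}.

Section UltrafilterPoset.
Context d (B : ctbDistrLatticeType d) (U : ultrafilter B).

Local Notation T := {x : B | uf_set U x}.
Local Notation rle := (fun x y : T => is_true (sval y <= sval x)).

Fact uf_rle_refl (x : T) : rle x x.
Proof. exact: lexx. Qed.

Fact uf_rle_anti (x y : T) : rle x y -> rle y x -> x = y.
Proof.
case: x y => [x Ux] [y Uy] yx xy; apply: eq_exist => /=.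
by apply/le_anti/andP; split; [exact: xy | exact: yx].
Qed.

Fact uf_rle_trans (x y z : T) : rle x y -> rle y z -> rle x z.
Proof. by move=> yx zy; exact: le_trans zy yx. Qed.

Fact uf_rle_inh : inhabited T.
Proof. exact: inhabits (exist _ \top (uf_top U)). Qed.

Fact uf_rle_directed (x y : T) : exists z : T, rle x z /\ rle y z.
Proof.
exists (exist _ _ (uf_meet (svalP x) (svalP y))).
by split; [exact: leIl | exact: leIr].
Qed.

(* (U, >=): the larger element is the smaller one in the Boolean order. *)
Definition uf_ge : dirPoset :=
  DirPoset uf_rle_refl uf_rle_anti uf_rle_trans uf_rle_inh uf_rle_directed.

End UltrafilterPoset.

Section FiniteSubsets.
Context (K : choiceType).

Local Notation sub := (fun a b : {fset K} => is_true (fsubset a b)).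

Fact fsub_refl (a : {fset K}) : sub a a.
Proof. exact: fsubset_refl. Qed.

Fact fsub_anti (a b : {fset K}) : sub a b -> sub b a -> a = b.
Proof. by move=> ab ba; apply/eqP; rewrite eqEfsubset; apply/andP. Qed.

Fact fsub_trans (a b c : {fset K}) : sub a b -> sub b c -> sub a c.
Proof. exact: fsubset_trans. Qed.

Fact fsub_inh : inhabited {fset K}.
Proof. exact: inhabits fset0. Qed.

Fact fsub_directed (a b : {fset K}) : exists c, sub a c /\ sub b c.
Proof. by exists (fsetU a b); split; [exact: fsubsetUl | exact: fsubsetUr]. Qed.

Definition finite_subsets : dirPoset :=
  DirPoset fsub_refl fsub_anti fsub_trans fsub_inh fsub_directed.

End FiniteSubsets.

(* Main.v *)
(* Balcar and Franek: B has an independent family indexed by B itself.  Given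
   such a family x, no finite meet of x_i's lies below a finite join of lower
   bounds of infinite subfamilies, so some ultrafilter U contains every x_i but
   no lower bound of an infinite subfamily; sending u to the finite set
   {i | u <= x_i}, respectively a finite set of indices (of members of U) to the
   meet of these members, gives the two Tukey reductions.

   For the independent family, call b stable when all nonzero c <= b have ideals
   of the same cardinality and antichains of the same cardinalities.  Stable
   elements are dense.  Below a stable non-atom b, Vladimirov's lemma yields a
   long sequence in which each term splits everything generated by its
   predecessors; mixing this sequence along antichains reaches the size of the
   ideal below b, because that size is bounded by counting well-founded trees
   of sup-operations.  When the cardinalities of antichains below b have no
   maximum, one needs antichains that are independent of each other; they come
   from disjoint refinements.  Finally the families living below the members of
   a maximal disjoint set of stable elements are glued together, Hausdorff's
   construction taking care of the atoms. *)
From Stdlib Require Import Wellfounded List.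
Require Import Defs.
From mathcomp Require Import all_boot all_order finmap.
From mathcomp Require Import all_classical wochoice.

Set Implicit Arguments.
Unset Strict Implicit.
Unset Printing Implicit Defensive.

Import Order.CTheory Order.TTheory.

Local Open Scope classical_set_scope.
Local Open Scope order_scope.
Local Open Scope card_scope.

(** * Cardinalities *)

Definition emb (A B : Type) := exists f : A -> B, injective f.

Lemma emb_refl A : emb A A. Proof. by exists id. Qed.

Lemma emb_trans A B C : emb A B -> emb B C -> emb A C.
Proof. by move=> [f fI] [g gI]; exists (g \o f); exact: inj_comp. Qed.

Lemma emb_sig T (P : T -> Prop) : emb {x | P x} T.
Proof. by exists sval => -[x p] [y q] /= xy; exact: eq_exist. Qed.

Lemma emb_sub T (P Q : T -> Prop) :
  (forall x, P x -> Q x) -> emb {x | P x} {x | Q x}.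
Proof.
move=> PQ; exists (fun x => exist Q (sval x) (PQ _ (svalP x))).
by move=> [x p] [y q] [xy]; exact: eq_exist.
Qed.

Lemma emb_rel A B (R : A -> B -> Prop) :
  (forall a, exists b, R a b) -> (forall a a' b, R a b -> R a' b -> a = a') ->
  emb A B.
Proof.
move=> /choice[f fR] RI; exists f => a a' faa'.
by apply: RI (fR a) _; rewrite faa'.
Qed.

Lemma emb_empty A B : ~ inhabited A -> emb A B.
Proof.
move=> nA; have F (a : A) : False by apply: nA.
by exists (fun a => match F a with end) => a; case: (F a).
Qed.

Lemma emb_surj A B (g : A -> B) : (forall b, exists a, g a = b) -> emb B A.
Proof. by move=> gS; apply: (emb_rel gS) => b b' a <- <-. Qed.

Lemma emb_fun L A B : emb A B -> emb (L -> A) (L -> B).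
Proof.
move=> [f fI]; exists (fun h => f \o h) => h h' hh'.
by apply/funext => l; apply: fI; exact: (congr1 (@^~ l) hh').
Qed.

Lemma emb_dom L L' A : A -> emb L L' -> emb (L -> A) (L' -> A).
Proof.
move=> a0 [f fI].
pose g (h : L -> A) (l' : L') :=
  if pselect (exists l, f l = l') is left e then h (projT1 (cid e)) else a0.
exists g => h h' ghh'; apply/funext => l.
have := congr1 (@^~ (f l)) ghh'; rewrite /g.
case: pselect => [e|]; last by case; exists l.
by case: cid => l1 /= /fI ->.
Qed.

Lemma emb_prod A A' B B' : emb A A' -> emb B B' -> emb (A * B) (A' * B').
Proof.
move=> [f fI] [g gI]; exists (fun p => (f p.1, g p.2)).
by move=> [a b] [a' b'] [/fI -> /gI ->].
Qed.

(** Classically any index type has decidable equality, carried by [{classic I}]. *)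
Lemma existT_inj I (F : I -> Type) i (x y : F i) :
  existT F i x = existT F i y -> x = y.
Proof. exact: (@existT_inj2 {classic I}). Qed.

Lemma emb_sigT I (F G : I -> Type) :
  (forall i, emb (F i) (G i)) -> emb {i & F i} {i & G i}.
Proof.
move=> FG; pose f i := sval (cid (FG i)).
have fI i : injective (f i) by exact: svalP (cid (FG i)).
exists (fun p => existT G (projT1 p) (f _ (projT2 p))).
move=> [i x] [j y] /= p; have ij := existT_inj1 p; subst j.
by congr existT; apply: fI; exact: existT_inj p.
Qed.

(** Recursion in which a value is only prescribed by a property relative to earlier values. A
    witness is chosen when there is one and [w0] is returned otherwise; existence of witnesses can
    then be shown afterwards, for the finished [f]. *)
Lemma wf_rec_choice T W (R : T -> T -> Prop) (w0 : W)
    (P : forall x, (forall y, R y x -> W) -> W -> Prop) :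
  well_founded R ->
  exists f : T -> W, forall x,
    (exists w, P x (fun y _ => f y) w) -> P x (fun y _ => f y) (f x).
Proof.
move=> wfR.
pose F x (rec : forall y, R y x -> W) := 
  if pselect (exists w, P x rec w) is left e then sval (cid e) else w0.
pose f := Fix wfR (fun=> W) F.
have fE x : f x = F x (fun y _ => f y).
  rewrite /f Fix_eq // => y g g' gg'; congr F.
  by apply: functional_extensionality_dep => z; apply/funext => ?; exact: gg'.
exists f => x [w Pw]; rewrite [in X in P x _ X]fE /F.
by case: pselect => [e|[]]; [exact: svalP (cid e) | exists w].
Qed.

(** * Well-orders and comparison of cardinalities *)

Definition wo T (lt : T -> T -> Prop) :=
  [/\ well_founded lt, forall x y z, lt x y -> lt y z -> lt x z
    & forall x y, [\/ lt x y, x = y | lt y x]].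

Definition seg T (lt : T -> T -> Prop) (x : T) := {y | lt y x}.

Lemma wo_exists T : exists lt : T -> T -> Prop, wo lt.
Proof.
have [R woR] := well_ordering_principle {classic T}.
(* Totality, antisymmetry and transitivity all come from unique least elements of sets with two or
   three points. *)
have tot x y : R x y \/ R y x.
  have [|z [[zxy zmin] _]] := woR (pred2 x y); first by exists x; rewrite !inE eqxx.
  move: zxy zmin; rewrite !inE => /orP[/eqP->|/eqP->] zmin.
    by left; apply: zmin; rewrite !inE eqxx orbT.
  by right; apply: zmin; rewrite !inE eqxx.
have anti x y : R x y -> R y x -> x = y.
  move=> xy yx; have [|z [_ uz]] := woR (pred2 x y); first by exists x;
    rewrite !inE eqxx.
  have rr u : R u u by case: (tot u u).
  have <- : z = x.
    by apply: uz; split; rewrite ?inE ?eqxx // => u; rewrite !inE => /orP[]/eqP->.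
  by apply: uz; split; rewrite ?inE ?eqxx ?orbT // => u; rewrite !inE => /orP[]/eqP->.
have wmin (A : set T) a : A a -> exists2 z, A z & forall y, A y -> R z y.
  move=> Aa; have [|z [[zA zm] _]] := woR (mem A); first by exists a; exact/mem_set.
  exists z; first exact: set_mem zA.
  by move=> y Ay; apply: zm; exact/mem_set.
exists (fun x y => R x y /\ x <> y); split.
- move=> x; apply: contrapT => nx.
  have [z nz zm] := wmin [set x | ~ Acc (fun x y => R x y /\ x <> y) x] x nx.
  apply: nz; constructor=> y [yz ynz]; apply: contrapT => /zm zy.
  by apply: ynz; exact: anti.
- move=> x y z [xy xny] [yz ynz]; have xz : R x z.
    have [w] := wmin [set u | [\/ u = x, u = y | u = z]] x (Or31 _ _ erefl).
    move=> [->|->|->] wm; first by apply: wm; constructor.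
      by case: xny; apply: anti => //; apply: wm; constructor.
    by case: ynz; apply: anti => //; apply: wm; constructor.
  split=> // xzE; subst z.
  by apply: xny; exact: anti.
- move=> x y; have [->|xy] := pselect (x = y); first by constructor.
  by have [|] := tot x y => ?; [constructor 1|constructor 3]; split => // yx;
    apply: xy.
Qed.

Lemma wo_min T (lt : T -> T -> Prop) (A : set T) a :
  well_founded lt -> A a -> exists2 m, A m & forall x, lt x m -> ~ A x.
Proof.
move=> wf Aa; apply: contrapT => nm.
elim/(well_founded_ind wf): a Aa => a IH Aa.
by apply: nm; exists a => // x xa Ax; exact: IH Ax.
Qed.

Lemma wo_sig T (lt : T -> T -> Prop) (P : T -> Prop) :
  wo lt -> wo (fun x y : {x | P x} => lt (sval x) (sval y)).
Proof.
move=> [wf tr tri]; split.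
- exact: wf_inverse_image.
- by move=> x y z; exact: tr.
- move=> x y; have [xy|xy|xy] := tri (sval x) (sval y);
  [constructor 1| |constructor 3] => //.
  by constructor 2; case: x y xy => x p [y q] /= xy; exact: eq_exist.
Qed.

(* The greedy map [T -> W] avoiding earlier values either never stops, or its
   values on some initial segment exhaust [W]. *)
Lemma wo_compare T (lt : T -> T -> Prop) W :
  wo lt -> (exists a, emb W (seg lt a)) \/ emb T W.
Proof.
move=> [wf tr tri]; have [[w0]|nW] := pselect (inhabited W); last first.
  have [[a]|nT] := pselect (inhabited T).
    by left; exists a; exact: emb_empty.
  by right; exact: emb_empty.
have [f fP] := wf_rec_choice w0 (fun x rec w => forall y (h : lt y x), rec y h <> w)
  wf.
have [fnew|] := pselect (forall x, exists w, forall y, lt y x -> f y <> w).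
  right; exists f => x y xy.
  have [lxy|//|lyx] := tri x y.
    by case: (fP y (fnew y) x lxy).
  by case: (fP x (fnew x) y lyx).
move=> /existsNP[a /forallNP an]; left; exists a.
apply: (@emb_surj _ _ (fun y : seg lt a => f (sval y))) => w.
apply: contrapT => nw; apply: (an w) => y ya yw.
by apply: nw; exists (exist _ y ya).
Qed.

Lemma emb_total A B : emb A B \/ emb B A.
Proof.
have [lt wlt] := wo_exists A.
have [[a BA]|] := wo_compare B wlt; last by left.
by right; apply: emb_trans BA (emb_sig _).
Qed.

Lemma emb_seg_sig T (lt : T -> T -> Prop) (P : T -> Prop) (x : {x | P x}) :
  emb (seg (fun y z : {x | P x} => lt (sval y) (sval z)) x) (seg lt (sval x)).
Proof.
exists (fun y => exist (fun z => lt z (sval x)) (sval (sval y)) (svalP y)).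
by move=> [[y p] r] [[z q] r'] /= [yz]; apply: eq_exist; exact: eq_exist.
Qed.

(** Well-order the disjoint union of all [X i]. The least proper segment receiving some [X i]
    selects the index; if no proper segment receives any, all [X j] have the size of the union. *)
Lemma emb_min I (X : I -> Type) (i0 : I) :
  exists i, forall j, emb (X i) (X j).
Proof.
have XT i : emb (X i) {i & X i}.
  by exists (existT X i) => x y; exact: existT_inj.
have [lt wlt] := wo_exists {i & X i}; have [wf tr tri] := wlt.
have [[a [i ia]]|na] := pselect (exists a i, emb (X i) (seg lt a)); last first.
  exists i0 => j; have [[a ja]|] := wo_compare (X j) wlt.
    by case: na; exists a, j.
  exact: emb_trans.
have [m [k km] mmin] := wo_min wf (A := [set a | exists i, emb (X i) (seg lt a)])
  (ex_intro _ i ia).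
exists k => j; apply: emb_trans km _.
have [[b jb]|//] := wo_compare (X j) (wo_sig (fun x => lt x m) wlt).
case: (mmin (sval b) (svalP b)); exists j; apply: emb_trans jb _.
exact: emb_seg_sig.
Qed.

(** An initial ordinal: if [T] embeds in proper segments, the order of the least such segment is
    pulled back to [T]. *)
Lemma wo_initial T : exists2 lt : T -> T -> Prop, wo lt &
  forall a, ~ emb T (seg lt a).
Proof.
have [lt wlt] := wo_exists T; have [wf tr tri] := wlt.
have [[a Ta]|na] := pselect (exists a, emb T (seg lt a)); last first.
  by exists lt => // a Ta; apply: na; exists a.
have [m [f fI] mmin] := wo_min wf (A := [set a | emb T (seg lt a)]) Ta.
pose g x := sval (f x); have gI : injective g.
  move=> x y; rewrite /g => gxy; apply: fI.
  by case: (f x) (f y) gxy => u p [v q] /= uv; exact: eq_exist.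
exists (fun x y => lt (g x) (g y)).
  split; first exact: wf_inverse_image.
    by move=> x y z; exact: tr.
  move=> x y; have [xy|xy|xy] := tri (g x) (g y);
    [constructor 1|constructor 2|constructor 3] => //.
  exact: gI.
move=> b Tb; apply: (mmin (g b) (svalP (f b))).
apply: emb_trans Tb _.
exists (fun y => exist (fun z => lt z (g b)) (g (sval y)) (svalP y)).
by move=> [y p] [z q] /= [/gI yz]; exact: eq_exist.
Qed.

(** Greedy choice along [lt]: the values taken before [t] are too few to exhaust [N t]. *)
Lemma emb_select T W (N : T -> set W) (lt : T -> T -> Prop) : wo lt ->
  (forall t, ~ emb {w | N t w} (seg lt t)) ->
  exists2 f : T -> W, injective f & forall t, N t (f t).
Proof.
move=> [wf tr tri] Nbig; have [[t0]|nT] := pselect (inhabited T); last first.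
  have F (t : T) : False by apply: nT.
  by exists (fun t => match F t with end) => t; case: (F t).
have new f t : exists w, N t w /\ forall y, lt y t -> f y <> w.
  apply: contrapT => /forallNP nw; apply: (Nbig t).
  apply: (@emb_rel _ _ (fun w y => f (sval y) = sval w)) =>
    [[w Nw]|[w Nw] [w' Nw'] y /= -> ww'].
    apply: contrapT => /forallNP nf; apply: (nw w); split=> // y yt yw.
    exact: (nf (exist _ y yt)).
  exact: eq_exist.
have [[w0]|nW] := pselect (inhabited W); last first.
  by case: (Nbig t0); apply: emb_empty => -[[w _]]; case: nW.
have [f fP] := wf_rec_choice w0
  (fun x rec w => N x w /\ forall y (h : lt y x), rec y h <> w) wf.
exists f => [x y xy|t]; last by have [] := fP t (new f t).
case: (tri x y) => [lxy|//|lyx].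
  by have [_ /(_ x lxy)] := fP y (new f y).
by have [_ /(_ y lyx)/nesym] := fP x (new f x).
Qed.

(** * Arithmetic of infinite cardinalities *)

Lemma embP A B : emb A B <-> [set: A] #<= [set: B].
Proof.
split=> [[f fI]|/card_leP[f]].
  have [g] : $|{injfun [set: A] >-> [set: B]}|; last exact: inj_card_le.
  by apply/injfunPex; exists f => // x y _ _ /fI.
exists (fun a => sval (f (exist _ a (in_setT a)))) => a a' ff.
have fI : {in [set: [set: A]] &, injective f} by exact: inj.
have /val_inj/fI : val (f (exist _ a (in_setT a))) = val (f (exist _ a' (in_setT a')))
  by [].
by move=> /(_ (in_setT _) (in_setT _))[].
Qed.

Lemma inf_finite T : ~ emb nat T <-> finite_set [set: T].
Proof.
by split=> [nT|fT /embP /infiniteP//]; apply: contrapT => /infiniteP /embP.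
Qed.

(** Hilbert's hotel along the sequence [f]. *)
Lemma emb_option T : emb nat T -> emb (option T) T.
Proof.
move=> [f fI].
apply: (@emb_rel _ _ (fun o t => [\/ o = None /\ t = f 0%N,
    exists n, o = Some (f n) /\ t = f n.+1
  | o = Some t /\ forall n, f n <> t])).
  move=> [x|]; last by exists (f 0%N); constructor 1.
  have [[n <-]|nx] := pselect (exists n, f n = x).
    by exists (f n.+1); constructor 2; exists n.
  by exists x; constructor 3; split=> // n fn; apply: nx; exists n.
move=> o o' t [[-> ->]|[n [-> ->]]|[-> nt]] [[-> e]|[m [-> e]]|[-> nt']] //.
- by have := fI _ _ e.
- by case: (nt' 0%N).
- by have := fI _ _ e.
- by case: (fI _ _ e) => ->.
- by case: (nt' n.+1).
- by case: (nt 0%N).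
- by case: (nt m.+1).
Qed.

Lemma sq_equiv A B : emb A B -> emb B A -> emb (A * A) A -> emb (B * B) B.
Proof.
move=> AB BA AA; apply: emb_trans (emb_prod BA BA) _.
exact: emb_trans AA AB.
Qed.

(* [T * T] is ordered by maximum, then lexicographically; if [T] embeds in no
   proper initial segment of itself, it embeds in none of [T * T]. *)
Lemma sq_step T (lt : T -> T -> Prop) : wo lt ->
  (forall a, emb nat (seg lt a) -> emb (seg lt a * seg lt a) (seg lt a)) ->
  emb nat T -> emb (T * T) T.
Proof.
move=> wlt sq Tinf; have [wf tr tri] := wlt.
have [[m Tm]|nm] := pselect (exists m, emb T (seg lt m)).
  apply: (sq_equiv (emb_sig _) Tm); apply: sq; exact: emb_trans Tm.
pose mx x y := if pselect (lt x y) then y else x.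
pose le x y := lt x y \/ x = y.
have irr x : ~ lt x x by elim/(well_founded_ind wf): x => x IH /[dup] /IH.
have mxl x y : le x (mx x y) by rewrite /mx; case: pselect; [left|right].
have mxr x y : le y (mx x y).
  by rewrite /mx; case: pselect => [|nxy];
    [right|case: (tri x y) => // ?; [right|left]].
pose ltp (p q : T * T) := lt (mx p.1 p.2) (mx q.1 q.2) \/
  mx p.1 p.2 = mx q.1 q.2 /\ (lt p.1 q.1 \/ p.1 = q.1 /\ lt p.2 q.2).
have wltp : wo ltp.
  split.
  - move=> p; move: {2}(mx p.1 p.2) (erefl (mx p.1 p.2)) => m.
    elim/(well_founded_ind wf): m p => m IHm [x];
      elim/(well_founded_ind wf): x => x IHx y.
    elim/(well_founded_ind wf): y => y IHy /= mE;
      constructor=> -[x' y'] [/=|/= [e [|[e' ]]]].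
    + by move=> l; apply: (IHm (mx x' y')); rewrite -?mE.
    + by move=> l; apply: (IHx x' l); rewrite e.
    + by subst x'; move=> l; apply: (IHy y' l); rewrite e.
  - move=> p q r [a|[a [b|[b c]]]] [a'|[a' [b'|[b' c']]]].
    all: rewrite /ltp.
    all: try by left; rewrite ?a -?a' //; apply: tr a a'.
    + by right; rewrite a a'; split=> //; left; exact: tr b b'.
    + by right; rewrite a a'; split=> //; left; rewrite -b'.
    + by right; rewrite a a'; split=> //; left; rewrite b.
    + by right; rewrite a a'; split=> //; right; rewrite b b'; split=> //;
      exact: tr c c'.
  - move=> [x y] [x' y']; rewrite /ltp /=.
    have [a|a|a] := tri (mx x y) (mx x' y');
      [by constructor 1; left| |by constructor 3; left].
    have [b|b|b] := tri x x';
      [by constructor 1; right; split=> //; left| |by constructor 3; right;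
      split=> //; left].
    have [c|c|c] := tri y y'; [constructor 1|constructor 2|constructor 3].
    + by right; split=> //; right.
    + by rewrite b c.
    + by right; split=> //; right.
have [[p Tp]|//] := wo_compare T wltp.
(* Pairs below [p] have both coordinates at most [m], so [T] embeds in the square of [S], a proper
   segment plus one point. An infinite segment would absorb that square, against [nm]; a finite one
   would make [T] finite. *)
pose m := mx p.1 p.2; pose S := {y | le y m}.
have TSS : emb T (S * S).
  apply: emb_trans Tp _.
  have lm q : ltp q p -> le (mx q.1 q.2) m by move=> [|[]]; [left|right].
  have letr x y z : le x y -> le y z -> le x z.
    by move=> [a|->//] [b|<-]; left => //; exact: tr a b.
  exists (fun q : seg ltp p =>
    (exist (le^~ m) _ (letr _ _ _ (mxl (sval q).1 (sval q).2) (lm _ (svalP q))),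
     exist (le^~ m) _ (letr _ _ _ (mxr (sval q).1 (sval q).2) (lm _ (svalP q))))).
  by move=> [[x y] hx] [[x' y'] hy] /= [ex ey]; subst x' y'; exact: eq_exist.
have Sopt : emb S (option (seg lt m)).
  apply: (@emb_rel _ _ (fun x o =>
    if o is Some y then sval x = sval y else sval x = m)).
    by move=> [x [xm|xm]]; [exists (Some (exist _ x xm))|exists None].
  by move=> [x px] [y py] [z|] /= xz yz; apply: eq_exist; rewrite xz yz.
have [fS|iS] := pselect (emb nat (seg lt m)).
  case: nm; exists m; apply: emb_trans TSS _.
  have Sm := emb_trans Sopt (emb_option fS).
  exact: emb_trans (emb_prod Sm Sm) (sq _ fS).
suff : finite_set [set: S * S] by move/inf_finite => []; exact: emb_trans TSS.
have finS : finite_set [set: S].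
  apply/inf_finite => /emb_trans /(_ Sopt) /embP /infiniteP; apply.
  have -> : [set: option (seg lt m)] = None |` (Some @` setT).
    by apply/seteqP; split=> -[x|] // _; [right; exists x|left].
  rewrite finite_setU; split; first exact: finite_set1.
  exact/finite_image/inf_finite.
by have := finite_setX finS finS; rewrite setXTT.
Qed.

Theorem emb_square T : emb nat T -> emb (T * T) T.
Proof.
have [lt wlt] := wo_exists T; apply: (sq_step wlt).
have [wf _ _] := wlt; elim/(well_founded_ind wf) => a IH.
apply: (sq_step (wo_sig (fun x => lt x a) wlt)) => b bi.
have e1 := emb_seg_sig lt b.
have e2 : emb (seg lt (sval b)) (seg (fun x y : seg lt a => lt (sval x) (sval y)) b).
  have tr : forall x y z, lt x y -> lt y z -> lt x z by case: wlt.
  exists (fun y => exist (fun y : seg lt a => lt (sval y) (sval b))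
    (exist _ (sval y) (tr _ _ _ (svalP y) (svalP b))) (svalP y)).
  by move=> [x ?] [y ?] [/= xy]; exact: eq_exist.
apply: (sq_equiv e2 e1); apply: IH; first exact: (svalP b).
exact: emb_trans bi e1.
Qed.

Lemma emb_seq T : emb nat T -> emb (seq T) T.
Proof.
move=> Ti; have [g gI] : emb (option (T * T)) T.
  apply: emb_trans (emb_option Ti).
  have [f fI] := emb_square Ti.
  by exists (omap f) => -[x|] [y|] //= [/fI ->].
pose code := fix code (s : seq T) :=
  if s is x :: s' then g (Some (x, code s')) else g None.
by exists code; elim=> [|x s IH] [|y t] /gI // [-> /IH ->].
Qed.

Lemma emb_sum X A B : emb nat X -> emb A X -> emb B X -> emb (A + B) X.
Proof.
move=> Xi [f fI] [g gI]; have [n nI] := Xi; apply: emb_trans (emb_square Xi).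
exists (fun s => match s with inl a => (n 0%N, f a) | inr b => (n 1%N, g b) end).
by move=> [a|b] [a'|b'] [] => [/fI ->|/nI|/nI|/gI ->].
Qed.

Lemma emb_inf_square Z : emb nat (Z * Z) -> emb nat Z.
Proof.
move=> ZZ; apply: contrapT => /inf_finite fZ.
have := finite_setX fZ fZ; rewrite setXTT => fZZ.
exact: (inf_finite _).2 fZZ ZZ.
Qed.

(** The larger factor is infinite, so it absorbs its own square, which contains the product. *)
Lemma emb_prod_or X Y Z : emb nat X -> emb X (Y * Z) -> emb X Y \/ emb X Z.
Proof.
move=> Xi; wlog YZ : Y Z / emb Y Z => [H XYZ|XYZ].
  have [YZ|ZY] := emb_total Y Z; first exact: H.
  have [] // := H Z Y ZY _; [|by right|by left].
  by apply: emb_trans XYZ _; exists (fun p => (p.2, p.1)) => -[a b] [c d] [-> ->].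
have XZZ := emb_trans XYZ (emb_prod YZ (emb_refl Z)).
right; apply: (emb_trans XZZ); apply: emb_square.
exact: emb_inf_square (emb_trans Xi XZZ).
Qed.

(** * Independent families and the Tukey type *)

Lemma finite_In T (l : seq T) : finite_set [set x | List.In x l].
Proof.
elim: l => [|x l IH]; first by apply: sub_finite_set (finite_set0 T) => x.
have -> : [set y | List.In y (x :: l)] = (x |` [set y | List.In y l])%classic.
  by apply/seteqP; split=> y [->|yl]; [left|right|left|right].
by rewrite finite_setU; split=> //; exact: finite_set1.
Qed.

Section Independence.
Context d (B : ctbDistrLatticeType d).
Implicit Types (x y z a b c e : B).

Lemma disj_mono x y z : x <= y -> y `&` z = \bot -> x `&` z = \bot.
Proof. by move=> xy /eqP; rewrite disj_leC => yz; apply/eqP;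
  rewrite disj_leC (le_trans xy). Qed.

Lemma le_disj_bot x y z : x <= y -> x <= z -> y `&` z = \bot -> x = \bot.
Proof. by move=> xy xz yz; apply/eqP; rewrite -lex0 -yz lexI xy. Qed.

Lemma nle_meetC x y : ~~ (x <= y) -> x `&` ~` y != \bot.
Proof. by rewrite disj_leC complK. Qed.

Definition consistent I (l : seq (I * bool)) :=
  forall i, List.In (i, true) l -> ~ List.In (i, false) l.

Definition lit x (s : bool) := if s then x else ~` x.

(* Instead of a nonzero finite meet we ask for a nonzero lower bound [e <= b] of
   the prescribed literals. *)
Definition indep b I (x : I -> B) := forall l, consistent l ->
  exists e, [/\ e != \bot, e <= b &
    forall i s, List.In (i, s) l -> e <= lit (x i) s].

Lemma indep_emb b I J (x : I -> B) : emb J I -> indep b x ->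
  exists y : J -> B, indep b y.
Proof.
move=> [f fI] xI; exists (x \o f) => l lc.
have [|e [e0 eb eP]] := xI [seq (f p.1, p.2) | p <- l].
  move=> i /List.in_map_iff[[j s] [[<- /= ->] jl]]
    /List.in_map_iff[[k t] [[/fI -> /= ->]]].
  exact: lc.
exists e; split=> // j s jl; apply: (eP (f j)).
by apply/List.in_map_iff; exists (j, s).
Qed.

Definition proper_filter (F : set B) := [/\ F \top, ~ F \bot,
  forall x y, F x -> F y -> F (x `&` y) & forall x y, x <= y -> F x -> F y].

Lemma ultrafilter_ext (F : set B) : proper_filter F ->
  exists U : ultrafilter B, F `<=` uf_set U.
Proof.
move=> [F1 F0 FI FU].
(* The condition is put on the union with [F] because the empty chain has empty union, which is no
   filter by itself. *)
have [|A [[A1 A0 AI AU] Amax]] :=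
  @Zorn_bigcup _ (fun S => proper_filter (S `|` F)%classic).
  move=> C CP Ctot; split.
  - by right.
  - by move=> [[S CS S0]|//]; have [_ + _ _] := CP _ CS; apply; left.
  - move=> x y [[S CS Sx]|Fx] [[R CR Ry]|Fy].
    + have [SR|RS] := Ctot _ _ CS CR.
        have [_ _ + _] := CP _ CR => /(_ x y (or_introl (SR _ Sx)) (or_introl Ry)).
        by move=> [?|?]; [left; exists R|right].
      have [_ _ + _] := CP _ CS => /(_ x y (or_introl Sx) (or_introl (RS _ Ry))).
      by move=> [?|?]; [left; exists S|right].
    + have [_ _ + _] := CP _ CS => /(_ x y (or_introl Sx) (or_intror Fy)).
      by move=> [?|?]; [left; exists S|right].
    + have [_ _ + _] := CP _ CR => /(_ x y (or_intror Fx) (or_introl Ry)).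
      by move=> [?|?]; [left; exists R|right].
    + by right; exact: FI.
  - move=> x y xy [[S CS Sx]|Fx]; last by right; exact: FU Fx.
    have [_ _ _ /(_ x y xy (or_introl Sx))] := CP _ CS.
    by move=> [?|?]; [left; exists S|right].
have ultra x : (A `|` F)%classic x \/ (A `|` F)%classic (~` x).
  have [|nx] := pselect ((A `|` F)%classic x); [by left|right].
  (* [G] is the filter generated by the maximal one and [x]. It would be proper if the complement of
     [x] were missing, contradicting maximality. *)
  pose G := [set y | exists2 g, (A `|` F)%classic g & g `&` x <= y].
  have AFG y : (A `|` F)%classic y -> G y by move=> h; exists y => //; exact: leIl.
  apply: contrapT => ncx; apply: (Amax G).
    split=> [y Ay|GA]; first by apply: AFG; left.
    by apply: nx; left; apply: GA; exists \top => //; rewrite meet1x.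
  have GF : (G `|` F)%classic = G by apply/setUidPl => y Fy; apply: AFG; right.
  rewrite /= GF.
  split.
  - exact: AFG.
  - move=> [g Ag]; rewrite lex0 disj_leC => gx; apply: ncx; exact: AU Ag.
  - move=> y z [g Ag gy] [h Ah hz]; exists (g `&` h); first exact: AI.
    by rewrite lexI (le_trans _ gy) ?(le_trans _ hz) // leI2 ?leIl ?leIr.
  - by move=> y z yz [g Ag gy]; exists g => //; exact: le_trans yz.
by exists (Ultrafilter A1 A0 AI AU ultra) => x Fx; right.
Qed.

Lemma ultrafilter_of_indep I (x : I -> B) : indep \top x ->
  exists U : ultrafilter B, (forall i, uf_set U (x i)) /\
    (forall u, uf_set U u -> finite_set [set i | u <= x i]).
Proof.
move=> xI.
pose bad b := infinite_set [set i | b <= x i].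
(* The filter generated by all [x i] and the complements of bad elements; quantifying over lower
   bounds [z] replaces finite meets. *)
pose F := [set y | exists l m, (forall b, List.In b m -> bad b) /\
  (forall z, (forall i, List.In i l -> z <= x i) ->
             (forall b, List.In b m -> z <= ~` b) -> z <= y)].
have [|U FU] := @ultrafilter_ext F.
  split.
  - by exists [::], [::]; split=> // z _ _; exact: lex1.
  - move=> [l [m [mbad lm]]].
    (* A bad [b] lies below infinitely many [x k], hence below one with [k] outside [l].
       Independence then gives a nonzero element below the [x i] for [i] in [l] and disjoint from
       these [x k], hence from every [b] in [m]. *)
    have [ks [kl km]] : exists ks, (forall k, List.In k ks -> ~ List.In k l) /\
        forall b, List.In b m -> exists2 k, List.In k ks & b <= x k.
      elim: m mbad {lm} => [|b m IH] mbad; first by exists [::].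
      have [|ks [kl km]] := IH; first by move=> b' ?; apply: mbad; right.
      have [k bk nk] : exists2 k, b <= x k & ~ List.In k l.
        apply: contrapT => nk; apply: (mbad b (or_introl erefl)).
        apply: sub_finite_set (finite_In l) => i bi.
        by apply: contrapT => il; apply: nk; exists i.
      exists (k :: ks); split=> [k' [<-//|/kl//]|b' [<-|/km[k' ? ?]]].
        by exists k => //; left.
      by exists k' => //; right.
    have [|e [e0 _ eP]] := xI
      ([seq (i, true) | i <- l] ++ [seq (i, false) | i <- ks]).
      move=> i /List.in_app_iff[|] /List.in_map_iff[j [] [//] <- jl].
      by move=> /List.in_app_iff[|] /List.in_map_iff[k [] [//] -> /kl].
    case/negP: e0; rewrite -lex0; apply: lm => [i il|b /km[k kk bk]].
      apply: (eP i true); apply/List.in_app_iff; left.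
      by apply/List.in_map_iff; exists i.
    rewrite lexC (le_trans bk) // lexC; apply: (eP k false).
    by apply/List.in_app_iff; right; apply/List.in_map_iff; exists k.
  - move=> y z [l [m [mb my]]] [l' [m' [mb' mz]]].
    exists (l ++ l'), (m ++ m'); split=> [b /List.in_app_iff[/mb|/mb']//|w wl wm].
    have wl1 i : List.In i l -> w <= x i by move=> h; apply/wl/List.in_app_iff; left.
    have wl2 i : List.In i l' -> w <= x i by move=> h; apply/wl/List.in_app_iff;
      right.
    have wm1 b : List.In b m -> w <= ~` b by move=> h; apply/wm/List.in_app_iff; left.
    have wm2 b : List.In b m' -> w <= ~` b by move=> h; apply/wm/List.in_app_iff;
      right.
    by rewrite lexI my ?mz.
  - move=> y z yz [l [m [mb my]]]; exists l, m; split=> // w wl wm.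
    by apply: le_trans yz; exact: my.
exists U; split=> [i|u Uu].
  by apply: FU; exists [:: i], [::]; split=> // z zx _; apply: zx; left.
apply: contrapT => ubad; apply: (@uf_proper _ _ U).
rewrite -(meetxC u); apply: uf_meet => //.
by apply: FU; exists [::], [:: u]; split=> [b [<-|]|z _ zu] //; apply: zu; left.
Qed.

Lemma tukey_top_of_indep (x : B -> B) : indep \top x ->
  exists U : ultrafilter B, forall K : choiceType, [set: K] #= [set: B] ->
    tukey_equiv (uf_ge U) (finite_subsets K).
Proof.
move=> xI; have [U [Ux Ufin]] := ultrafilter_of_indep xI.
exists U => K /card_eqPle[/embP[f fI] /embP[g gI]]; split.
(* [h] inverts the injection [g] on the members of [U]; any other index is sent to the top element,
   which is harmless in meets. *)
- pose h (k : K) : uf_ge U :=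
    if pselect (exists u : uf_ge U, g (sval u) = k) is left e then sval (cid e)
    else exist _ _ (uf_top U).
  have hg u : h (g (sval u)) = u.
    rewrite /h; case: pselect => [e|[]]; last by exists u.
    case: cid => /= v /gI; case: u v {e} => u Uu [v Uv] /= vu; exact: eq_exist.
  pose H (s : seq K) := (\meet_(k <- s) sval (h k))%O.
  have HU s : uf_set U (H s).
    rewrite /H; elim: s => [|k s IH]; first by rewrite big_nil; exact: uf_top.
    by rewrite big_cons; apply: uf_meet => //; exact: svalP (h k).
  exists (fun s : {fset K} => exist _ _ (HU s)) => A Acof u.
  have [s As us] := Acof [fset g (sval u)]%fset.
  exists (exist _ _ (HU s)); first by exists s.
  suff : H s <= sval (h (g (sval u))) by rewrite hg.
  have : g (sval u) \in (s : seq K) by apply: (fsubsetP us); rewrite inE.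
  rewrite /H; elim: (s : seq K) => //= k t IH;
    rewrite big_cons inE => /predU1P[<-|/IH le].
    exact: leIl.
  by rewrite leIxr.
- have ffin (u : uf_ge U) : finite_set [set k : K | sval u <= x (f k)].
    have fS : f @` [set k | sval u <= x (f k)] #= [set k | sval u <= x (f k)].
      by apply: inj_card_eq => k k' _ _; exact: fI.
    rewrite -(eq_finite_set fS); apply: sub_finite_set (Ufin _ (svalP u)).
    by move=> _ [k ? <-].
  exists (fun u => fset_set [set k : K | sval u <= x (f k)]) => A Acof s.
  have HU (t : seq K) : uf_set U (\meet_(k <- t) x (f k))%O.
    elim: t => [|k t IH]; first by rewrite big_nil; exact: uf_top.
    by rewrite big_cons; apply: uf_meet.
  have [u Au us] := Acof (exist _ _ (HU s)).
  exists (fset_set [set k : K | sval u <= x (f k)]); first by exists u.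
  apply/fsubsetP => k ks; rewrite in_fset_set // inE /=; apply: (le_trans us) => /=.
  have {}ks : k \in (s : seq K) := ks.
  elim: (s : seq K) ks => //= j t IH; rewrite big_cons inE => /predU1P[<-|/IH le].
    exact: leIl.
  by rewrite leIxr.
Qed.

End Independence.

(** * Subproducts *)

Lemma emb_max_In I (X : I -> Type) (F : seq I) i0 : List.In i0 F ->
  exists2 m, List.In m F & forall i, List.In i F -> emb (X i) (X m).
Proof.
elim: F i0 => // j F IH i0 _; case: F IH => [|k F] IH.
  by exists j => [|i [<-|//]]; [left | exact: emb_refl].
have [m mF mmax] := IH k (or_introl erefl).
have [jm|mj] := emb_total (X j) (X m).
  by exists m => [|i [<-//|/mmax//]]; right.
exists j => [|i [<-|/mmax im]]; first by left.
  exact: emb_refl.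
exact: emb_trans im mj.
Qed.

Lemma map_eq_In A C (f g : A -> C) (F : seq A) : map f F = map g F ->
  forall a, List.In a F -> f a = g a.
Proof. by elim: F => //= b F IH [fg /IH H] a [<-|/H]. Qed.

Section Product.
Variables (U I : Type) (X : I -> Type).
Hypothesis (Uinf : emb nat U) (Xinf : forall i, emb nat (X i)).

(** The sets [J] whose subproduct is still as large as [U]. By [P_mono] and [P_split] they are
    closed upwards, and cutting one in two leaves a part of the same kind. *)
Let P (J : set I) := emb U (forall i : {i | J i}, X (sval i)).

Let P_mono (J J' : set I) : J `<=` J' -> P J -> P J'.
Proof.
move=> JJ' PJ; apply: (emb_trans PJ).
pose x0 i : X i := sval (cid (Xinf i)) 0%N.
exists (fun f (i : {i | J' i}) =>
  if pselect (J (sval i)) is left h then f (exist J (sval i) h) else x0 (sval i)).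
move=> f g fg; apply/functional_extensionality_dep => -[i Ji].
have := congr1 (@^~ (exist _ i (JJ' _ Ji))) fg => /=.
by case: pselect => // h; rewrite (Prop_irrelevance h Ji).
Qed.

Let P_split (J A : set I) : P J -> P (J `&` A)%classic \/ P (J `\` A)%classic.
Proof.
move=> PJ; apply: emb_prod_or => //; apply: (emb_trans PJ).
exists (fun f => (fun i : {i | (J `&` A)%classic i} =>
  f (exist J (sval i) (svalP i).1),
                  fun i : {i | (J `\` A)%classic i} =>
                    f (exist J (sval i) (svalP i).1))).
move=> f g [fg1 fg2]; apply/functional_extensionality_dep => -[i Ji].
have [Ai|nAi] := pselect (A i).
  have := congr1 (@^~ (exist _ i (conj Ji Ai))) fg1 => /=.
  by rewrite (Prop_irrelevance (proj1 _) Ji).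
have := congr1 (@^~ (exist _ i (conj Ji nAi))) fg2 => /=.
by rewrite (Prop_irrelevance (proj1 _) Ji).
Qed.

Let P_fin : (forall i, ~ emb U (X i)) ->
  forall s : seq I, ~ P [set i | List.In i s].
Proof.
move=> nU; elim=> [|i s IH] Ps.
  have [f fI] := emb_trans Uinf Ps.
  suff : 0%N = 1%N by [].
  by apply: fI; apply/functional_extensionality_dep => -[i []].
have [[f fI]|Pd] := P_split [set i] Ps; last first.
  by apply: IH; apply: P_mono Pd => j [[<-|js] nj] //; case: nj.
apply: (nU i); exists (fun u => f u (exist _ i (conj (or_introl erefl) erefl))).
move=> u v uv; apply: fI; apply/functional_extensionality_dep => -[j [/= h ji]].
subst j.
by rewrite (Prop_irrelevance (conj h _) (conj (or_introl erefl) erefl)).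
Qed.

(* Either a single factor already dominates, or a subproduct of the same
   strength is indexed by [J] for which finite subsets [F] of [J] can be given
   distinct representatives whose factors dominate those indexed by [F]. *)
Lemma emb_product : emb U (forall i, X i) ->
  (exists i, emb U (X i)) \/
  exists (J : set I) (p : seq {i | J i} -> {i | J i}),
  [/\ injective p, emb U (forall i : {i | J i}, X (sval i)) &
      forall F i, List.In i F -> emb (X (sval i)) (X (sval (p F)))].
Proof.
move=> UX; have [|/forallNP nU] := pselect (exists i, emb U (X i)); [by left|right].
have PT : P setT.
  apply: (emb_trans UX); exists (fun f i => f (sval i)) => f g fg.
  by apply/functional_extensionality_dep => i;
    exact: (congr1 (@^~ (exist _ i Logic.I)) fg).
have [[J0 PJ0] J0min] := @emb_min {J | P J} (fun J => {i | sval J i}) (exist _ _ PT).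
(* The indices of factors strictly smaller than [X e]. Starting from [J0] of least cardinality, pass
   to such a set for the smallest possible [X e], if there is any with [P]; then no further set of
   this kind has [P]. So the indices with factors dominating [X e] keep [P], and by minimality of
   [J0] they are as numerous as [J]. *)
pose below (J : set I) e : set I := (J `\` [set i | emb (X e) (X i)])%classic.
have [J [JJ0 PJ Jbelow]] : exists J : set I,
  [/\ J `<=` J0, P J & forall e, J e -> ~ P (below J e)].
  have [[e0 Pe0]|ne] := pselect (exists e, P (below J0 e)); last first.
    by exists J0; split=> // e _ Pe; apply: ne; exists e.
  have [[e Pe] emin] := @emb_min {e | P (below J0 e)} (fun e => X (sval e))
    (exist _ e0 Pe0).
  exists (below J0 e); split=> // [i []//|e' [J0e' ne'] Pe']; apply: ne'.
  have Pe'' : P (below J0 e') by apply: P_mono Pe' => i [[]].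
  exact: (emin (exist _ e' Pe'')).
have JT e : J e -> emb {i | J i} {i | (J `&` [set i | emb (X e) (X i)])%classic i}.
  move=> Je; have [PA|/(Jbelow _ Je)//] := P_split [set i | emb (X e) (X i)] PJ.
  exact: (emb_trans (emb_sub JJ0) (J0min (exist _ _ PA))).
have Jinf : emb nat {i | J i}.
  apply: contrapT => /inf_finite/(@finite_seqP {classic {i | J i}})[s sJ].
  apply: (P_fin nU (s := map sval s)); apply: P_mono PJ => i Ji /=.
  apply/List.in_map_iff; exists (exist _ i Ji); split=> //.
  have : [set: {i | J i}] (exist _ i Ji) by [].
  rewrite sJ /=; elim: (s : seq {classic {i | J i}}) => //= j t IH;
    rewrite inE => /predU1P[->|/IH]; by [left|right].
have [lt wlt lti] := wo_initial (seq {i | J i}).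
(* For each [F] the candidates dominate its largest factor, so there are as many of them as members
   of [J], which is also the number of finite sequences. *)
have [|p pI pN] := @emb_select _ {i | J i}
  (fun F j => forall i, List.In i F -> emb (X (sval i)) (X (sval j))) lt wlt.
  move=> F NF; apply: (lti F); apply: emb_trans NF; apply: (emb_trans (emb_seq Jinf)).
  case: F => [|j F].
    by exists (fun j => exist _ j (fun i (h : List.In i [::]) => match h with end)) =>
      x y [].
  have [m mF mmax] := @emb_max_In {i | J i} (fun i => X (sval i)) (j :: F) j
    (or_introl erefl).
  apply: (emb_trans (JT _ (svalP m))).
  apply: (@emb_rel _ _ (fun i j => sval i = sval (sval j))) =>
    [[i [Ji mi]]|[i hi] [i' hi'] k /= ik ik'].
    suff h : forall k, List.In k (j :: F) -> emb (X (sval k)) (X i).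
      by exists (exist _ (exist _ i Ji) h).
    by move=> k kF; exact: emb_trans (mmax k kF) mi.
  by apply: eq_exist; rewrite ik ik'.
by exists J, p.
Qed.

End Product.

(** * Mixing and gluing independent families *)

Lemma list_bound T K (R : T -> T -> seq K -> Prop) :
  (forall p q, exists F, forall F', (forall k, List.In k F -> List.In k F') ->
    R p q F') ->
  forall l, exists F, forall p q, List.In p l -> List.In q l -> R p q F.
Proof.
move=> H l.
have /choice[f fP] : forall pq : T * T, exists F, forall F',
  (forall k, List.In k F -> List.In k F') ->
    R pq.1 pq.2 F' by move=> [p q]; exact: H.
exists (List.flat_map (fun p => List.flat_map (fun q => f (p, q)) l) l) => p q pl ql.
apply: (fP (p, q)) => k kf; apply/List.in_flat_map; exists p; split=> //.
by apply/List.in_flat_map; exists q.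
Qed.

(** The image of a list under a partial function given only as a relation; it also serves to filter
    lists by undecidable predicates. *)
Lemma list_rel T W (R : T -> W -> Prop) :
  (forall x w w', R x w -> R x w' -> w = w') ->
  forall l, exists O, forall w, List.In w O <-> exists2 x, List.In x l & R x w.
Proof.
move=> Rf; elim=> [|x l [O OP]]; first by exists [::] => w; split=> // -[].
have [[w0 xw0]|nx] := pselect (exists w, R x w).
  exists (w0 :: O) => w; split=> [[<-|/OP[x' ? ?]]|[x' [<-|x'l] xw]].
  - by exists x => //; left.
  - by exists x' => //; right.
  - by left; exact: Rf xw.
  - by right; apply/OP; exists x'.
exists O => w; split=> [/OP[x' ? ?]|[x' [<-|x'l] xw]].
- by exists x' => //; right.
- by case: nx; exists w.
- by apply/OP; exists x'.
Qed.

Lemma mem_In (T : eqType) (x : T) (s : seq T) : x \in s <-> List.In x s.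
Proof.
elim: s => //= y s IH; rewrite inE; split=> [/predU1P[->|/IH]|[->|/IH xs]].
- by left.
- by right.
- by rewrite eqxx.
- by rewrite xs orbT.
Qed.

(** One argument of disagreement for each pair of distinct functions in the list suffices. *)
Lemma finite_separation Lam (K : Lam -> Type) (V : forall a, K a -> Type)
    (l : seq {a & forall k : K a, V a k}) :
  exists F : forall a, seq (K a), forall a (g g' : forall k, V a k),
    List.In (existT _ a g) l -> List.In (existT _ a g') l ->
    (forall k, List.In k (F a) -> g k = g' k) -> g = g'.
Proof.
suff H a : exists F : seq (K a), forall g g' : (forall k, V a k),
    List.In (existT _ a g) l -> List.In (existT _ a g') l ->
    (forall k, List.In k F -> g k = g' k) -> g = g'.
  by exists (fun a => sval (cid (H a))) => a; exact: svalP (cid (H a)).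
pose R (p q : {a & forall k : K a, V a k}) (F : seq (K a)) :=
  forall g g' : (forall k, V a k), p = existT _ a g -> q = existT _ a g' ->
  (forall k, List.In k F -> g k = g' k) -> g = g'.
suff RF p q : exists F, forall F', (forall k, List.In k F -> List.In k F') ->
  R p q F'.
  by have [F FP] := list_bound RF l; exists F => g g' gl gl';
    exact: FP gl gl' _ _ erefl erefl.
have [[g [g' [-> ->]]]|npq] :=
  pselect (exists g g' : forall k, V a k, p = existT _ a g /\ q = existT _ a g');
  last first.
  by exists [::] => F _ g g' pg qg; case: npq; exists g, g'.
have [[k kg]|nk] := pselect (exists k, g k <> g' k).
  exists [:: k] => F FP h h' eg eg' hF.
  have gh := existT_inj eg; have gh' := existT_inj eg'; subst h h'.
  by case: kg; apply: hF; apply: FP; left.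
exists [::] => F _ h h' eg eg' _.
have gh := existT_inj eg; have gh' := existT_inj eg'; subst h h';
  apply/functional_extensionality_dep => k.
by apply: contrapT => kg; apply: nk; exists k.
Qed.

Section Mixing.
Context d (B : ctbDistrLatticeType d) (Bc : complete_lattice B).
Implicit Types (x y z b : B).

Definition bsup (A : set B) : B := sval (cid (Bc A)).

Lemma bsup_ub (A : set B) x : A x -> x <= bsup A.
Proof. by rewrite /bsup; case: cid => /= s [sub _]; exact: sub. Qed.

Lemma bsup_le (A : set B) y : (forall x, A x -> x <= y) -> bsup A <= y.
Proof. by rewrite /bsup; case: cid => /= s [_ sle] Ay; apply: sle. Qed.

Lemma bsup_meet0 (A : set B) y : (forall x, A x -> y `&` x = \bot) ->
  y `&` bsup A = \bot.
Proof.
move=> H; apply/eqP; rewrite disj_leC lexC; apply: bsup_le => x Ax.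
by rewrite lexC -disj_leC; apply/eqP/H.
Qed.

Definition pairwise_disj W (g : W -> B) :=
  forall w w', w <> w' -> g w `&` g w' = \bot.

Definition joint_antichains b (Lam : Type) (P : Lam -> Type) (dd : forall a, P a -> B)
  :=
  (forall a, pairwise_disj (dd a)) /\
  forall (F : forall a, P a) (l : seq Lam),
    exists e, [/\ e != \bot, e <= b & forall a, List.In a l -> e <= dd a (F a)].

(** Inside the piece [dd a (F a)] the mixed element agrees with [s a (F a) g], all other pieces
    being disjoint from it. Literals therefore need only be realized within one suitable piece of
    each antichain. *)
Lemma indep_mix b (Lam : Type) (J G : Lam -> Type) (dd : forall a, J a -> B)
    (s : forall a, J a -> G a -> B) :
  (forall a, pairwise_disj (dd a)) ->
  (forall l : seq ({a & G a} * bool), consistent l ->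
    exists (F : forall a, J a) e, [/\ e != \bot, e <= b &
      forall a g t, List.In (existT _ a g, t) l ->
        e <= dd a (F a) /\ e <= lit (s a (F a) g) t]) ->
  indep b (fun p : {a & G a} =>
    bsup [set dd (projT1 p) j `&` s _ j (projT2 p) | j in setT]).
Proof.
move=> dis H l /H[F [e [e0 eb eP]]]; exists e; split=> // -[a g] t /eP[ed es].
case: t es => /= es.
  by apply: (@le_trans _ _ (dd a (F a) `&` s a (F a) g));
    [rewrite lexI ed|apply: bsup_ub; exists (F a)].
rewrite lexC; apply: bsup_le => _ [j _ <-].
have [->|/dis dj] := pselect (j = F a);
  first by rewrite lexC (le_trans es) // leC leIr.
by rewrite lexC (le_trans ed) // lexC leIxl // -disj_leC; apply/eqP/dj.
Qed.

(* Hausdorff: at the place [(F, O)] the member indexed by [g] is present iff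
   the restriction of [g] to [F] is listed in [O]. *)
Lemma indep_hausdorff b (Lam : Type) (L : Lam -> Type)
    (dd : forall a, seq (L a) * seq (seq bool) -> B) :
  joint_antichains b dd -> exists x : {a & L a -> bool} -> B, indep b x.
Proof.
move=> [dis jnt]; eexists; apply: (indep_mix (dd := dd) (s := fun a j g =>
  if map g j.1 \in j.2 then \top else \bot)) => // l lc.
have [F FP] := @finite_separation Lam L (fun _ _ => bool) (map fst l).
pose G a := L a -> bool.
(* [O] lists the restrictions to [F a] of the functions required positively. As [F] separates the
   functions in [l], no function required negatively has its restriction there. *)
have /(_ _)/cid Om a : exists O : seq (seq bool), forall v, List.In v O <->
    exists2 g, List.In (existT G a g, true) l & v = map g (F a).
  have [|O OP] := @list_rel _ _ (fun (p : {a & G a} * bool) (v : seq bool) =>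
      exists2 g, p = (existT G a g, true) & v = map g (F a)) _ l.
    move=> p v v' [g -> ->] [h e ->].
    have gh : existT G a g = existT G a h := congr1 fst e.
    by rewrite (existT_inj gh).
  exists O => v; split=> [/OP[p pl [g pg ->]]|[g gl ->]].
    by exists g; rewrite // -pg.
  by apply/OP; exists (existT G a g, true) => //; exists g.
pose pl a := (F a, sval (Om a)).
have [e [e0 eb eP]] := jnt pl (map (fun p => projT1 p.1) l).
have inl a g t : List.In (existT G a g, t) l -> List.In (existT G a g) (map fst l).
  by move=> h; apply/List.in_map_iff; exists (existT _ a g, t).
exists pl, e; split=> // a g t agl; split.
  by apply: eP; apply/List.in_map_iff; exists (existT _ a g, t).
rewrite /pl /=; case: (Om a) => /= O OP.
case: t agl => agl /=.
  by rewrite (mem_In _ _).2 ?lex1 //; apply/OP; exists g.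
case: ifPn => [/mem_In/OP[h hl gh]|_]; last by rewrite compl0 lex1.
have gh' := FP a g h (inl _ _ _ agl) (inl _ _ _ hl) (map_eq_In gh).
by subst h; case: (lc _ hl agl).
Qed.

Definition below b := {x : B | x <= b}.

(** If no single ideal is as large as [U], index the mixture by finite sets [F] of places: below the
    representative [p F] there are enough independent elements to code the restriction of a function
    to [F], and distinct [F] have disjoint representatives. *)
Lemma indep_glue U (N : set B) : emb nat U ->
  pairwise_disj (fun n : {x | N x} => sval n) ->
  (forall n, N n -> emb nat (below n) /\ exists x : below n -> B, indep n x) ->
  emb U (forall n : {x | N x}, below (sval n)) ->
  exists x : U -> B, indep \top x.
Proof.
move=> Ui dis HN UN.
have Xi (n : {x | N x}) : emb nat (below (sval n)) := (HN _ (svalP n)).1.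
pose x (n : {x | N x}) := sval (cid (HN _ (svalP n)).2).
have xI n : indep (sval n) (x n) := svalP (cid (HN _ (svalP n)).2).
have wk n : indep \top (x n).
  by move=> l /xI[e [e0 _ eP]]; exists e; split=> //; exact: lex1.
have [[n Un]|[J [p [pI UJ pP]]]] := emb_product Ui Xi UN.
  exact: indep_emb Un (wk n).
suff [y yI] : exists y : {_ : unit & forall i : {i | J i}, below (sval (sval i))} ->
  B, indep \top y.
  apply: indep_emb yI; apply: (emb_trans UJ).
  by exists (existT (fun=> _) tt) => f g fg; exact: existT_inj fg.
have code F : exists c : (forall i : {i | J i}, below (sval (sval i))) ->
  below (sval (sval (p F))),
    forall f g, c f = c g -> forall i, List.In i F -> f i = g i.
  have [kk kkI] := emb_seq (Xi (sval (p F))).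
  have io i : exists h : below (sval (sval i)) -> below (sval (sval (p F))),
    List.In i F -> injective h.
    have [iF|niF] := pselect (List.In i F); first by have [h hI] := pP F i iF;
      exists h.
    by have [h _] := Xi (sval (p F)); exists (fun=> h 0%N).
  exists (fun f => kk (map (fun i => sval (cid (io i)) (f i)) F)) => f g /kkI fg i iF.
  by apply: (svalP (cid (io i)) iF); exact: map_eq_In fg i iF.
eexists; apply: (@indep_mix \top unit (fun=> seq {i | J i})
  (fun=> forall i : {i | J i}, below (sval (sval i)))
  (fun _ F => sval (sval (p F)))
    (fun _ F f => x (sval (p F)) (sval (cid (code F)) f))).
  move=> _ F F' FF'; apply: dis => pFF; apply: FF'; apply: pI.
  by case: (p F) (p F') pFF => u h [v k] /= uv; exact: eq_exist.
move=> l lc.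
have [F FP] := @finite_separation unit (fun=> {i | J i})
  (fun _ i => below (sval (sval i))) (map fst l).
have [|e [e0 eb eP]] :=
  xI (sval (p (F tt))) [seq (sval (cid (code (F tt))) (projT2 q.1), q.2) | q <- l].
  move=> k /List.in_map_iff[[[[] f] t] [[<- /= ->] fl]]
    /List.in_map_iff[[[[] g] u] [[/= gf ->] gl]].
  have fg : f = g.
    apply: (FP tt); [apply/List.in_map_iff..|].
    - by exists (existT _ tt f, true).
    - by exists (existT _ tt g, false).
    - by move=> i iF; exact: esym (svalP (cid (code (F tt))) _ _ gf i iF).
  by subst g; exact: lc fl gl.
exists F, e; split=> //.
move=> [] g t gl; split=> //; apply: eP; apply/List.in_map_iff.
by exists (existT _ tt g, t).
Qed.

End Mixing.

(** * Antichains and Vladimirov's lemma *)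

Lemma cantor W : ~ emb (W -> bool) W.
Proof.
move=> [f fI]; pose D w := `[< exists g, f g = w /\ g w = false >].
have [Df|nDf] := boolP (D (f D)).
  by move/asboolP: (Df) => [g [/fI -> ]]; rewrite Df.
by move/asboolP: (nDf); apply; exists D; split=> //; exact/negbTE.
Qed.

Section Splitting.
Context d (B : ctbDistrLatticeType d) (Bc : complete_lattice B).
Implicit Types (x y z b c : B).

Lemma bsup_disj W (g h : W -> B) w : pairwise_disj g -> (forall w, h w <= g w) ->
  g w `&` bsup Bc (range h) = h w.
Proof.
move=> gd hg; apply/le_anti/andP; split; last first.
  by rewrite lexI hg; apply: bsup_ub; exists w.
suff : bsup Bc (range h) <= ~` g w `|` h w.
  by move=> H; rewrite (le_trans (leI2 (lexx _) H)) // meetUr meetxC join0x leIr.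
apply: bsup_le => _ [w' _ <-].
have [->|ww'] := pselect (w = w'); first exact: leUr.
rewrite (@le_trans _ _ (~` g w)) ?leUl // -disj_leC.
by apply/eqP; apply: (disj_mono (hg w')); apply: gd => /esym.
Qed.

Lemma max_disjoint (P : set B) : exists D : set B, [/\ D `<=` P,
  forall x, D x -> x != \bot,
  forall x y, D x -> D y -> x <> y -> x `&` y = \bot &
  forall x, P x -> x != \bot -> exists2 y, D y & y `&` x != \bot].
Proof.
pose Q (D : set B) := [/\ D `<=` P, forall x, D x -> x != \bot &
  forall x y, D x -> D y -> x <> y -> x `&` y = \bot].
have [|D [[DP D0 Dd] Dmax]] := @Zorn_bigcup _ Q.
  move=> C CQ Ctot; split.
  - by move=> x [S CS Sx]; have [+ _ _] := CQ _ CS; apply.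
  - by move=> x [S CS Sx]; have [_ + _] := CQ _ CS; apply.
  - move=> x y [S CS Sx] [R CR Ry].
    have [SR|RS] := Ctot _ _ CS CR.
      by have [_ _] := CQ _ CR; apply=> //; exact: SR.
    by have [_ _] := CQ _ CS; apply=> //; exact: RS.
exists D; split=> // x Px x0; apply: contrapT => nx.
have Dx y : D y -> y `&` x = \bot.
  by move=> Dy; apply: contrapT => yx; apply: nx; exists y => //; exact/eqP.
apply: (Dmax (D `|` [set x])%classic).
  split=> [y|DD]; first by left.
  have xD : D x by apply: DD; right.
  by move: (Dx _ xD); rewrite meetxx => /eqP; rewrite (negbTE x0).
split.
- by move=> y [/DP//|->].
- by move=> y [/D0//|->].
- move=> y z [Dy|->] [Dz|->] yz //; [exact: Dd|exact: Dx|].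
  by rewrite meetC; exact: Dx.
Qed.

Definition antichain b W (g : W -> B) :=
  [/\ forall w, g w != \bot, forall w, g w <= b & pairwise_disj g].

(* The cardinality of [W] is that of an antichain below [b]. *)
Definition small b W := exists g : W -> B, antichain b g.

Lemma small_emb b W W' : emb W W' -> small b W' -> small b W.
Proof.
move=> [f fI] [g [g0 gb gd]]; exists (g \o f); split=> [w|w|w w' ww'] /=;
  [exact: g0|exact: gb|].
by apply: gd => /fI.
Qed.

Lemma small_le b c W : b <= c -> small b W -> small c W.
Proof.
by move=> bc [g [g0 gb gd]]; exists g; split=> // w; exact: le_trans bc.
Qed.

(** Replaces an arbitrary index type by a subset of [B], so that [emb_min] can range over antichain
    cardinalities. *)
Lemma antichain_range b W (g : W -> B) : antichain b g ->
  emb W {x | range g x} /\ small b {x | range g x}.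
Proof.
move=> [g0 gb gd]; split.
  exists (fun w => exist (range g) (g w) (ex_intro2 _ _ w Logic.I erefl)) =>
    w w' [gw].
  apply: contrapT => /gd; rewrite gw meetxx => /eqP.
  by rewrite (negbTE (g0 w')).
exists sval; split=> [[x [w wT wx]]|[x [w wT wx]]|[x [w wT wx]] [y [w' wT' wy]] xy]
  /=.
- by rewrite -wx.
- by rewrite -wx.
- rewrite -wx -wy; apply: gd => ww'; apply: xy; apply: eq_exist.
  by rewrite -wx -wy ww'.
Qed.

(** Take a maximal disjoint family of elements lying below members of [Y], and for each a member of
    [Y] above it. Any part of some [y] outside their supremum would meet the family. *)
Lemma small_sup b (Y : set B) : (forall y, Y y -> y <= b) ->
  exists W (h : W -> B), [/\ small b W, forall w, Y (h w) &
    bsup Bc Y = bsup Bc (range h)].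
Proof.
move=> Yb; have [D [DP D0 Dd Dmax]] := max_disjoint [set x | exists2 y, Y y & x <= y].
pose h (w : {x | D x}) := s2val (cid2 (DP _ (svalP w))).
have hY w : Y (h w) := s2valP (cid2 (DP _ (svalP w))).
have hw w : sval w <= h w := s2valP' (cid2 (DP _ (svalP w))).
exists {x | D x}, h; split=> //.
  exists sval; split=> [[x Dx]|[x Dx]|[x Dx] [y Dy] xy] /=; first exact: D0.
    by have [y Yy xy] := DP _ Dx; rewrite (le_trans xy) // Yb.
  by apply: Dd => // xy'; apply: xy; exact: eq_exist.
apply/le_anti/andP; split; last first.
  by apply: bsup_le => _ [w _ <-]; exact: bsup_ub.
apply: bsup_le => y Yy; rewrite -[X in _ <= X]complK -disj_leC.
apply/negPn/negP => y0.
have [|x Dx] := Dmax (y `&` ~` bsup Bc (range h)) _ y0.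
  by exists y => //; exact: leIl.
apply/negP; rewrite negbK -lex0 -(meetxC (bsup Bc (range h))) leI2 //.
  rewrite (le_trans (hw (exist _ x Dx))) //; apply: bsup_ub.
  by exists (exist _ x Dx).
exact: leIr.
Qed.

(** Complete subalgebras of the principal ideal of [b], with complements relative to [b]. *)
Definition closed_below b (A : set B) := [/\ A `<=` [set x | x <= b],
  forall x, A x -> A (b `&` ~` x) & forall S : set B, S `<=` A -> A (bsup Bc S)].

Lemma closed_below_meet b (A : set B) x y : closed_below b A -> A x -> A y ->
  A (x `&` y).
Proof.
move=> [Ab AN AS] Ax Ay.
have -> : x `&` y = b `&` ~` (bsup Bc [set b `&` ~` x; b `&` ~` y]).
  apply/le_anti/andP; split.
    rewrite lexI (le_trans (leIl _ _) (Ab _ Ax)) /= lexC; apply: bsup_le => _ [->|->];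
      by rewrite lexC complI complK (le_trans _ (leUr _ _)) ?leIl ?leIr.
  have H z : A z -> (b `&` ~` z) <= bsup Bc [set b `&` ~` x; b `&` ~` y] -> 
      b `&` ~` (bsup Bc [set b `&` ~` x; b `&` ~` y]) <= z.
    move=> Az le; rewrite (@le_trans _ _ (b `&` ~` (b `&` ~` z))) //.
      by rewrite leI2 // leC.
    by rewrite complI complK meetUr meetxC join0x leIr.
  by rewrite lexI !H //; apply: bsup_ub; [right|left].
by apply: (AN); apply: AS => _ [->|->]; exact: AN.
Qed.

(* If no principal ideal below [b] is the trace of the complete subalgebra
   [A], every nonzero member of [A] is split by a single element. *)
Lemma vladimirov b (A : set B) : closed_below b A ->
  (forall c, c != \bot -> c <= b -> exists2 x, x <= c & forall y, A y -> x <> c `&` y)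
    ->
  exists2 u, u <= b &
    forall x, A x -> x != \bot -> x `&` u != \bot /\ x `&` ~` u != \bot.
Proof.
move=> Acl now; have [Ab AN AS] := Acl.
have AI x y := @closed_below_meet b A x y Acl.
(* The upper projection of [x] to [A], its minimality being expressed through disjointness. *)
have upr x : x <= b -> exists y,
  [/\ A y, x <= y & forall z, A z -> z `&` x = \bot -> z `&` y = \bot].
  move=> xb; pose S := [set z | A z /\ z `&` x = \bot].
  exists (b `&` ~` bsup Bc S); split.
  - by apply: AN; apply: AS => z [].
  - rewrite lexI xb /= -disj_leC; apply/eqP/bsup_meet0 => z [_].
    by rewrite meetC.
  - move=> z Az zx; apply: (@le_disj_bot _ _ _ (bsup Bc S) (~` bsup Bc S)).
    + by rewrite leIxl // bsup_ub.
    + by rewrite meetCA leIxr // leIr.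
    + exact: meetxC.
pose splits u e := forall x, A x -> x != \bot -> x <= e -> x `&` u != \bot /\
  x `&` ~` u != \bot.
(* Let [x] below [c] be no trace of [A], and let [p], [q] be the projections of [x] and of [c] minus
   [x]. Then [x] splits every nonzero member of [A] below the meet of [c], [p], [q]; were that meet
   zero, [x] would be the trace of [p]. *)
have loc c : A c -> c != \bot -> exists e,
  [/\ A e, e != \bot, e <= c & exists u, splits u e].
  move=> Ac c0; have [x xc xA] := now c c0 (Ab _ Ac).
  have [p [Ap xp pmin]] := upr x (le_trans xc (Ab _ Ac)).
  have [|q [Aq yq qmin]] := upr (c `&` ~` x); first by rewrite leIxl // Ab.
  exists ((c `&` p) `&` q); split.
  - by apply: (AI) => //; exact: AI.
  - apply/negP => /eqP cpq; apply: (xA p Ap); apply/le_anti/andP; split.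
      by rewrite lexI xc.
    rewrite -[X in _ <= X]complK -disj_leC; apply/eqP.
    apply: (le_disj_bot _ _ cpq); first exact: leIl.
    by rewrite (le_trans _ yq) // leI2 // leIl.
  - by rewrite -meetA leIl.
  - exists x => z Az z0; rewrite !lexI => /andP[/andP[zc zp] zq]; split.
      apply/negP => /eqP/(pmin _ Az); rewrite meet_l // => /eqP.
      by rewrite (negbTE z0).
    apply/negP => /eqP zx; have /(qmin _ Az) : z `&` (c `&` ~` x) = \bot.
      by rewrite meetCA zx meetx0.
    by rewrite meet_l // => /eqP; rewrite (negbTE z0).
(* Local splitting elements are joined along a maximal disjoint family of places where they work. *)
have [D [DP D0 Dd Dmax]] := max_disjoint [set e | A e /\ exists u, splits u e].
pose u (w : {x | D x}) := sval (cid (DP _ (svalP w)).2).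
have uP w : splits (u w) (sval w) := svalP (cid (DP _ (svalP w)).2).
have dis : pairwise_disj (fun w : {x | D x} => sval w).
  by move=> [x Dx] [y Dy] xy; apply: Dd => // xy'; apply: xy; exact: eq_exist.
pose h (w : {x | D x}) := sval w `&` u w.
have hw w : h w <= sval w by exact: leIl.
exists (bsup Bc (range h)).
  apply: bsup_le => _ [w _ <-]; rewrite (le_trans (hw w)) // Ab //.
  exact: (DP _ (svalP w)).1.
move=> x Ax x0; have [e [Ae e0 ex eP]] := loc x Ax x0.
have [w Dw we] := Dmax e (conj Ae eP) e0.
pose W : {x | D x} := exist _ w Dw.
have xw0 : x `&` w != \bot.
  apply: contraNneq we => xw; apply/eqP.
  by apply: (le_disj_bot _ _ xw); [rewrite leIxr|exact: leIl].
have [H1 H2] := uP W (x `&` w) (AI _ _ Ax (DP _ Dw).1) xw0 (leIr _ _).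
split.
  apply: contraNneq H1 => xu; apply/eqP; apply: (le_disj_bot _ _ xu).
    by rewrite -meetA leIl.
  apply: (@le_trans _ _ (h W)); first by rewrite /h leI2 // leIr.
  by apply: bsup_ub; exists W.
apply: contraNneq H2 => xu.
have hW : w `&` bsup Bc (range h) = h W by exact: (bsup_disj W dis hw).
rewrite -lex0 -xu lexI leIxl ?leIl //= -disj_leC.
apply/eqP; apply: (@le_disj_bot _ _ _ (h W) (~` u W)); last 1 first.
- by rewrite /h -meetA meetxC meetx0.
- by rewrite -hW leI2 // leIxl // leIr.
- by rewrite leIxl // leIr.
Qed.

End Splitting.

(** * Stable elements *)

Section Stable.
Context d (B : ctbDistrLatticeType d) (Bc : complete_lattice B).
Implicit Types (x y z b c : B).

Lemma emb_below b c : b <= c -> emb (below b) (below c).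
Proof.
by move=> bc; apply: (@emb_sub B (fun x => x <= b) (fun x => x <= c)) => x xb;
  exact: le_trans bc.
Qed.

Definition stable b := b != \bot /\ forall c, c != \bot -> c <= b ->
  emb (below b) (below c) /\ forall W, small b W -> small c W.

(** Two minimizations: [b1] has the smallest ideal below [x]; then, among the antichains below [b1]
    whose size is lost below some nonzero [c], take a smallest. Below its [c] no further size can be
    lost. *)
Lemma stable_dense x : x != \bot -> exists2 b, stable b & b <= x.
Proof.
move=> x0.
have [[b1 [b10 b1x]] b1min] := @emb_min {c | c != \bot /\ c <= x}
  (fun p => below (sval p))
    (exist (fun c => c != \bot /\ c <= x) x (conj x0 (lexx x))).
pose bad (W : set B) := small b1 {y | W y} /\
  exists c, [/\ c != \bot, c <= b1 & ~ small c {y | W y}].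
suff [c [c0 cb1 cP]] : exists c,
  [/\ c != \bot, c <= b1 & forall e, e != \bot -> e <= c ->
    forall W, small c W -> small e W].
  exists c; last exact: (le_trans cb1 b1x).
  split=> // e e0 ec; split; last exact: cP.
  apply: (emb_trans (emb_below cb1)).
  exact: (b1min (exist (fun c => c != \bot /\ c <= x) e
    (conj e0 (le_trans ec (le_trans cb1 b1x))))).
have step c W : c <= b1 -> small c W -> exists V : set B, [/\ emb W {y | V y},
    small c {y | V y} & forall e, e != \bot -> e <= b1 -> ~ small e W -> bad V].
  move=> cb1 [g gA]; have [WV Vs] := antichain_range gA.
  exists (range g); split=> // e e0 eb1 nW; split; first exact: small_le Vs.
  by exists e; split=> // /(small_emb WV).
have [[W0 W0bad]|nbad] := pselect (exists W, bad W); last first.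
  exists b1; split=> // e e0 eb W /(step _ _ (lexx b1))[V [_ _ Vbad]].
  by apply: contrapT => nW; apply: nbad; exists V; exact: Vbad nW.
have [[W [Ws [c [c0 cb1 nW]]]] Wmin] :=
  @emb_min {W | bad W} (fun W => {y | sval W y}) (exist _ W0 W0bad).
exists c; split=> // e e0 ec V Vs; apply: contrapT => nV.
have [V' [_ V's /(_ e e0 (le_trans ec cb1) nV) V'bad]] := step c V cb1 Vs.
by apply: (nW); apply: (small_emb _ V's); exact: (Wmin (exist _ V' V'bad)).
Qed.

Definition atomless b :=
  forall c, c != \bot -> c <= b -> exists e, [/\ e != \bot, e <= c & e != c].

(** An atom below [b] would have an ideal of two elements, while the ideal of [b] has at least
    three. *)
Lemma stable_atomless b : stable b -> (exists c, [/\ c <= b, c != \bot & c != b]) ->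
  atomless b.
Proof.
move=> [b0 bS] [x [xb x0 xnb]] c c0 cb; apply: contrapT => nc.
have c01 (e : below c) : sval e = \bot \/ sval e = c.
  case: e => e ec /=; have [->|e0] := eqVneq e \bot; [by left|right].
  by apply/eqP; apply: contrapT => /negP ec'; apply: nc; exists e.
have [[f fI] _] := bS c c0 cb.
have fE (u v : below b) : sval u != sval v -> sval (f u) != sval (f v).
  apply: contraNneq => fuv; apply/eqP; congr sval; apply: fI.
  by case: (f u) (f v) fuv => p ? [q ?] /= pq; exact: eq_exist.
have := fE (exist _ x xb) (exist _ b (lexx b)) xnb.
have := fE (exist _ x xb) (exist _ \bot (le0x b)) x0.
have := fE (exist _ b (lexx b)) (exist _ \bot (le0x b)) b0.
by case: (c01 (f (exist _ x xb))) => ->; case: (c01 (f (exist _ b (lexx b)))) => ->;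
  case: (c01 (f (exist _ \bot (le0x b)))) => ->; rewrite ?eqxx.
Qed.

(** * Sizes of antichains below an atomless stable element *)

Section BelowStable.
Variables (b : B) (bS : stable b).
Hypothesis bN : atomless b.

Let small_below c W : c != \bot -> c <= b -> small b W -> small c W.
Proof. by move=> c0 cb; exact: (bS.2 c c0 cb).2. Qed.

Lemma small_nat : small b nat.
Proof.
have /choice[h hP] c : exists e, c != \bot -> c <= b ->
  [/\ e != \bot, e <= c & e != c].
  have [c0|?] := pselect (c != \bot); last by exists c.
  have [cb|?] := pselect (c <= b); last by exists c.
  by have [e eP] := bN c0 cb; exists e.
pose f n := iter n h b.
have fP n : f n != \bot /\ f n <= b.
  elim: n => [|n [f0 fb]]; first by split; [exact: bS.1|exact: lexx].
  by have [h0 hc _] := hP _ f0 fb; split => //; exact: le_trans fb.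
have fS n : f n.+1 <= f n by have [f0 fb] := fP n; have [] := hP _ f0 fb.
have fm n m : (n <= m)%N -> f m <= f n.
  elim: m => [|m IH]; first by rewrite leqn0 => /eqP ->.
  rewrite leq_eqVlt => /predU1P[->//|]; rewrite ltnS => /IH.
  exact: le_trans.
have dis n m : (n < m)%N -> (f n `&` ~` f n.+1) `&` (f m `&` ~` f m.+1) = \bot.
  move=> nm; apply: (@le_disj_bot _ _ _ (f n.+1) (~` f n.+1)); last exact: meetxC.
    by rewrite leIxr // leIxl // fm.
  by rewrite leIxl // leIr.
exists (fun n => f n `&` ~` f n.+1); split=> [n|n|n m /eqP].
- apply: nle_meetC; have [f0 fb] := fP n; have [_ hc hn] := hP _ f0 fb.
  by apply: contra hn => fh; rewrite eq_le hc.
- by rewrite leIxl //; exact: (fP n).2.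
- by rewrite neq_ltn => /orP[/dis//|/dis]; rewrite meetC.
Qed.

(** Stability puts an antichain of size [V w] below each member of the first antichain. *)
Lemma small_sigT W (V : W -> Type) : small b W -> (forall w, small b (V w)) ->
  small b {w & V w}.
Proof.
move=> [g [g0 gb gd]] Vs.
pose h w := sval (cid (small_below (g0 w) (gb w) (Vs w))).
have hA w : antichain (g w) (h w) := svalP (cid (small_below (g0 w) (gb w) (Vs w))).
exists (fun p => h (projT1 p) (projT2 p)); split=> [[w v]|[w v]|[w v] [w' v'] wv] /=.
- by have [+ _ _] := hA w; exact.
- by have [_ + _] := hA w => /(_ v) /le_trans; apply.
- have [_ hw hd] := hA w; have [_ hw' _] := hA w'.
  have [ww'|/gd gg] := pselect (w = w'); last first.
    by apply: (disj_mono (hw v)); rewrite meetC; apply: (disj_mono (hw' v'));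
      rewrite meetC.
  by subst w'; apply: hd => vv'; apply: wv; rewrite vv'.
Qed.

Lemma small_prod W V : small b W -> small b V -> small b (W * V).
Proof.
move=> Ws Vs; apply: small_emb (small_sigT Ws (fun=> Vs)).
exists (fun p => existT (fun=> V) p.1 p.2) => -[w v] [w' v'] /= e.
have ww' : w = w' := existT_inj1 e; subst w'.
by rewrite (existT_inj e).
Qed.

Lemma small_unit : small b unit.
Proof. by apply: small_emb small_nat; exists (fun=> 0%N) => -[] []. Qed.

Lemma small_option W : small b W -> small b (option W).
Proof.
move=> Ws; pose V n := if n is 0%N then W else unit.
have Vs n : small b (V n) by case: n => [//|n]; exact: small_unit.
apply: small_emb (small_sigT small_nat Vs).
exists (fun o => if o is Some w then existT V 0%N w else existT V 1%N tt).
by move=> [w|] [w'|] // e; rewrite (existT_inj e).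
Qed.

(* Reading a list, descend one antichain per letter. *)
Lemma small_seq W : small b W -> small b (seq W).
Proof.
move=> /small_option Ws.
have Hc c : exists g : option W -> B, c != \bot -> c <= b -> antichain c g.
  have [c0|?] := pselect (c != \bot); last by exists (fun=> \bot).
  have [cb|?] := pselect (c <= b); last by exists (fun=> \bot).
  by have [g gA] := small_below c0 cb Ws; exists g.
have [G GA] := choice Hc.
(* [None] marks the end of a list, which makes a proper prefix disjoint from its extensions. *)
pose val := fix val (c : B) (s : seq W) :=
  if s is w :: s' then val (G c (Some w)) s' else G c None.
have valP s c : c != \bot -> c <= b -> val c s != \bot /\ val c s <= c.
  elim: s c => [|w s IH] c c0 cb; have [g0 gb gd] := GA c c0 cb; first by split;
    [exact: g0|exact: gb].
  have [v0 vb] := IH (G c (Some w)) (g0 _) (le_trans (gb _) cb).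
  by split=> //; exact: le_trans (gb (Some w)).
exists (val b); split=> [s|s|s t st].
- by have [] := valP s b bS.1 (lexx b).
- by have [] := valP s b bS.1 (lexx b).
suff H c : c != \bot -> c <= b ->
  val c s `&` val c t = \bot by exact: H bS.1 (lexx b).
elim: s c t st => [|w s IH] c [|w' t] st c0 cb //;
  have [g0 gb gd] := GA c c0 cb => /=.
- have [_ vb] := valP t (G c (Some w')) (g0 _) (le_trans (gb _) cb).
  by rewrite meetC; apply: (disj_mono vb); exact: gd.
- have [_ vb] := valP s (G c (Some w)) (g0 _) (le_trans (gb _) cb).
  by apply: (disj_mono vb); exact: gd.
have [ww'|ww'] := pselect (w = w').
  subst w'; apply: IH => [ss|//|]; first by apply: st; rewrite ss.
  exact: le_trans (gb _) cb.
have [_ vb] := valP s (G c (Some w)) (g0 _) (le_trans (gb _) cb).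
have [_ vb'] := valP t (G c (Some w')) (g0 _) (le_trans (gb _) cb).
apply: (disj_mono vb); rewrite meetC; apply: (disj_mono vb').
by apply: gd => -[/esym].
Qed.

(** The ideal of [b] is copied below each member of the antichain; the join of one choice per member
    determines every coordinate. *)
Lemma emb_pow_small W : small b W -> emb (W -> below b) (below b).
Proof.
move=> [g [g0 gb gd]].
pose io w := sval (cid (bS.2 _ (g0 w) (gb w)).1).
have ioI w : injective (io w) := svalP (cid (bS.2 _ (g0 w) (gb w)).1).
pose h (f : W -> below b) w := sval (io w (f w)).
have hg f w : h f w <= g w := svalP (io w (f w)).
have hb f : bsup Bc (range (h f)) <= b.
  by apply: bsup_le => _ [w _ <-]; exact: le_trans (gb w).
exists (fun f => exist (fun x => x <= b) _ (hb f)) => f f' [ff']; apply/funext => w;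
  apply: (ioI w).
have : h f w = h f' w by rewrite -(bsup_disj Bc w gd (hg f)) ff' bsup_disj.
by rewrite /h; case: (io w (f w)) (io w (f' w)) => p ? [q ?] /= pq; exact: eq_exist.
Qed.

Lemma below_inf : emb nat (below b).
Proof.
have [g gA] := small_nat; have [+ _] := antichain_range gA => /emb_trans; apply.
apply: (@emb_sub B (range g) (fun x => x <= b)) => _ [n _ <-]; by have [] := gA.
Qed.

(** Otherwise the power set of [W], which embeds in the ideal by [emb_pow_small], would embed in
    [W]. *)
Lemma small_nle W : small b W -> ~ emb (below b) W.
Proof.
move=> Ws bW; apply: (@cantor W); apply: emb_trans bW;
  apply: emb_trans (emb_pow_small Ws).
apply: emb_fun; have [f fI] := below_inf; exists (fun t : bool => f t).
by move=> [] [] // /fI.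
Qed.

End BelowStable.
End Stable.

(** * Independent families below a stable element *)

Lemma emb_existT I (F : I -> Type) i : emb (F i) {i & F i}.
Proof. by exists (existT F i) => x y; exact: existT_inj. Qed.

Lemma emb_sigT_prod I (F : I -> Type) Y : (forall i, emb (F i) Y) ->
  emb {i & F i} (I * Y).
Proof.
move=> FY; apply: (emb_trans (emb_sigT FY)).
by exists (fun p => (projT1 p, projT2 p)) => -[i y] [j z] [/= -> ->].
Qed.

Lemma emb_indicator L : emb L (L -> bool).
Proof.
exists (fun l m => `[< l = m >]) => l m /(congr1 (@^~ m)) lm.
by apply/asboolP; rewrite lm; exact/asboolP.
Qed.

Lemma wo_max_In T (lt : T -> T -> Prop) (l : seq T) x : wo lt -> List.In x l ->
  exists2 m, List.In m l & forall y, List.In y l -> lt y m \/ y = m.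
Proof.
move=> [wf tr tri]; elim: l x => // y l IH x _; case: l IH => [|z l] IH.
  by exists y => [|i [<-|//]]; [left | right].
have [m ml mmax] := IH z (or_introl erefl).
have [ym|ym|my] := tri y m.
- by exists m => [|i [<-|/mmax//]]; [right|left].
- by exists m => [|i [<-|/mmax//]]; [right|right].
- exists y => [|i [<-|/mmax [im|->]]]; [by left|by right| |by left].
  by left; exact: tr im my.
Qed.

Section Completion.
Context d (B : ctbDistrLatticeType d) (Bc : complete_lattice B).
Implicit Types (x y b c : B).

Definition cm b (G : set B) : set B :=
  [set x | forall A, closed_below Bc b A -> G `<=` A -> A x].

Lemma cm_gen b G : G `<=` cm b G.
Proof. by move=> x Gx A _; apply. Qed.

Lemma cm_mono b (G G' : set B) : G `<=` G' -> cm b G `<=` cm b G'.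
Proof. by move=> GG' x Gx A Acl G'A; apply: Gx => // y /GG'/G'A. Qed.

Lemma cm_closed b (G : set B) : G `<=` [set x | x <= b] -> closed_below Bc b (cm b G).
Proof.
move=> Gb; split.
- move=> x; apply=> //; split=> //.
    by move=> y _ /=; exact: leIl.
  by move=> S Sb /=; apply: bsup_le => y /Sb.
- by move=> x Gx A Acl GA; have [_ AN _] := Acl; apply: AN; exact: Gx.
- move=> S SG A Acl GA; have [_ _ AS] := Acl; apply: AS => x /SG; exact.
Qed.

Section System.
Variables (b : B) (bS : stable b).
Hypothesis bN : atomless b.
Variables (Lam : Type) (L : Lam -> Type).

(* The cardinality of [Ext Y] is the sum of the [|Y| ^ |L a|], which plays the
   role of [|Y| ^ (< sat b)] since the [L a] are cofinal among the small types. *)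
Definition Ext (Y : Type) := {a : Lam & L a -> Y}.

(** Two systems will satisfy these hypotheses: a single antichain of greatest cardinality, or all
    small segments of a well-order of [B] when there is no greatest cardinality. *)
Hypothesis Lsmall : forall a, small b (L a).
Hypothesis Lcof : forall W, small b W -> exists a, emb W (L a).
Hypothesis ELam : emb (Ext Lam) (Ext bool).
Hypothesis Ljoint : forall P : Lam -> Type, (forall a, small b (P a)) ->
  exists dd : forall a, P a -> B, joint_antichains b dd.

Lemma Ext_inf Y : emb bool Y -> emb nat (Ext Y).
Proof.
move=> Y2; have [a La] := Lcof (small_nat bS bN).
apply: (emb_trans La); apply: (emb_trans (emb_indicator _)).
by apply: (emb_trans (emb_fun _ Y2)); exact: (@emb_existT Lam (fun a => L a -> Y)).
Qed.

(** An iterated family amounts to its pattern of indices in [Ext Lam] together with one function on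
    the total index type, which is small by [small_sigT]. *)
Lemma Ext_Ext Y : emb bool Y -> emb (Ext Lam) (Ext Y) -> emb (Ext (Ext Y)) (Ext Y).
Proof.
move=> Y2 EY; have [y0 _] : exists y0 : Y, True by have [f _] := Y2; exists (f true).
pose G (p : Ext Lam) := forall l : L (projT1 p), L (projT2 p l) -> Y.
apply: (@emb_trans _ {p : Ext Lam & G p}).
  apply: (@emb_surj _ _ (fun q : {p : Ext Lam & G p} =>
    existT (fun a => L a -> Ext Y) (projT1 (projT1 q))
    (fun l => existT _ (projT2 (projT1 q) l) (projT2 q l)))) => -[a f].
  exists (existT G (existT _ a (fun l => projT1 (f l))) (fun l => projT2 (f l))) =>
    /=.
  by congr existT; apply/funext => l; case: (f l).
apply: (@emb_trans _ (Ext Lam * Ext Y)).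
  apply: emb_sigT_prod => p.
  have [c Tc] := Lcof (small_sigT bS (Lsmall (projT1 p))
    (fun l => Lsmall (projT2 p l))).
  apply: emb_trans (@emb_existT Lam (fun a => L a -> Y) c).
  apply: emb_trans (emb_dom y0 Tc).
  exists (fun (g : G p) t => g (projT1 t) (projT2 t)) => g g' gg'.
  apply/functional_extensionality_dep => l; apply/funext => k.
  exact: (congr1 (@^~ (existT _ l k)) gg').
apply: (emb_trans (emb_prod EY (emb_refl _))).
exact: emb_square (Ext_inf Y2).
Qed.

Definition closed_type G := emb nat G /\ emb (Ext G) G.

(* A complete subalgebra with [weak] many generators has fewer elements than
   the ideal below [b]. *)
Definition weak Z := exists G, [/\ emb Z G, closed_type G & ~ emb (below b) G].

Lemma weak_emb Z Z' : emb Z Z' -> weak Z' -> weak Z.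
Proof. by move=> ZZ' [G [Z'G Gc GM]]; exists G; split=> //; exact: emb_trans Z'G. Qed.

Lemma weak_sum Z Z' : weak Z -> weak Z' -> weak (Z + Z').
Proof.
move=> [G [ZG Gc GM]] [G' [ZG' Gc' GM']].
have [GG'|G'G] := emb_total G G'.
  by exists G'; split=> //; apply: emb_sum => //; [exact: Gc'.1|exact: emb_trans GG'].
by exists G; split=> //; apply: emb_sum => //; [exact: Gc.1|exact: emb_trans G'G].
Qed.

(* Terms for the members of the complete subalgebra generated by [Z]: joins of
   small families suffice, as every join below [b] is one. *)
Inductive tree (Z : Type) := Leaf of Z | Nor a of (L a -> tree Z).

Fixpoint val Z (v : Z -> B) (t : tree Z) : B :=
  match t with
  | Leaf z => v z
  | Nor a f => b `&` ~` bsup Bc (range (fun l => val v (f l)))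
  end.

Lemma tree_emb Z G : closed_type G -> emb Z G -> emb (tree Z) G.
Proof.
move=> [Gi EG] ZG; have [j jI] := emb_sum Gi ZG EG.
pose code := fix code (t : tree Z) : G := match t with
  | Leaf z => j (inl z)
  | Nor a f => j (inr (existT (fun a => L a -> G) a (fun l => code (f l)))) end.
exists code; elim=> [z|a f IH] [z'|a' f'] /= /jI // => [[->]//|e].
have e' : existT (fun a => L a -> G) a (fun l => code (f l)) = existT _ a'
  (fun l => code (f' l)) by case: e.
have aa' : a = a' := existT_inj1 e'; subst a'.
congr Nor; apply/funext => l; apply: IH.
exact: (congr1 (@^~ l) (existT_inj e')).
Qed.

Lemma val_closed Z (v : Z -> B) z0 : (forall z, v z <= b) -> v z0 = \bot ->
  closed_below Bc b (range (val v)).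
Proof.
move=> vb v0.
have tb t : val v t <= b by case: t => [z|a f] //=; exact: leIl.
have nt t : exists t', val v t' = b `&` ~` val v t.
  have [a [i _]] := Lcof (small_unit bS bN).
  exists (Nor (fun _ : L a => t)) => /=; congr (b `&` ~` _).
  apply/le_anti/andP; split; first by apply: bsup_le => _ [_ _ <-].
  by apply: bsup_ub; exists (i tt).
split=> [_ [t _ <-]|_ [t _ <-]|S SA]; first exact: tb.
  by have [t' <-] := nt t; exists t'.
have [|W [h [Ws hS ->]]] := @small_sup _ _ Bc b S.
  by move=> y /SA[t _ <-]; exact: tb.
have [a [i iI]] := Lcof Ws.
have /choice[tr trP] w : exists t, val v t = h w by have [t _ <-] := SA _ (hS w);
  exists t.
(* Places of [L a] outside the image of [i] get the leaf of value zero, which leaves the join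
   unchanged. The join itself is the complement of a [Nor] node. *)
pose f l := if pselect (exists w, i w = l) is left e then tr (sval (cid e)) else Leaf
  z0.
have [t tE] := nt (Nor f); exists t => //.
have -> : bsup Bc (range h) = bsup Bc (range (fun l => val v (f l))).
  apply/le_anti/andP; split; apply: bsup_le => _ [w _ <-].
    apply: bsup_ub; exists (i w) => //.
    rewrite /f; case: pselect => [e|[]]; last by exists w.
    by case: cid => /= w' /iI ->.
  rewrite /f; case: pselect => [e|_] /=; last by rewrite v0 le0x.
  by rewrite trP; apply: bsup_ub; exists (sval (cid e)).
rewrite tE /= complI complK meetUr meetxC join0x meetC meet_l //.
by apply: bsup_le => _ [l _ <-]; exact: tb.
Qed.

(** If the generated subalgebra traced the whole ideal of [c], terms would be at least as many as
    elements below [c], hence, by stability, below [b]; but they embed in [G]. *)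
Lemma weak_nowhere Z (v : Z -> B) : weak Z -> (forall z, v z <= b) ->
  forall c, c != \bot -> c <= b -> exists2 x, x <= c &
    forall y, cm b (range v) y -> x <> c `&` y.
Proof.
move=> [G [ZG Gc GM]] vb c c0 cb; apply: contrapT => nx; apply: GM.
apply: (emb_trans (bS.2 c c0 cb).1).
pose v' (o : option Z) := if o is Some z then v z else \bot.
apply: (@emb_trans _ (tree (option Z))); last first.
  by apply: tree_emb => //; apply: emb_trans (emb_option Gc.1); have [f fI] := ZG;
    exists (omap f) => -[x|] [y|] //= [/fI ->].
apply: (@emb_rel _ _ (fun (x : below c) t => sval x = c `&` val v' t)); last first.
  by move=> [x hx] [y hy] t /= xt yt; apply: eq_exist; rewrite xt yt.
move=> [x xc]; apply: contrapT => nt; apply: nx; exists x => // y Gy xy.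
have v'b z : v' z <= b by case: z => [z|] //=; exact: le0x.
have [|t _ tE] := Gy _ (val_closed (z0 := None) v'b erefl).
  by move=> _ [z _ <-]; exists (Leaf (Some z)).
by apply: nt; exists t; rewrite /= tE.
Qed.

(** * Splitting sequences and their independence *)

Section SplittingSequence.
Variables (T : Type) (lt : T -> T -> Prop) (Q : Type) (q : Q -> B).
Hypotheses (wlt : wo lt) (qb : forall i, q i <= b).
Hypothesis Tweak : forall t, weak (Q + seg lt t).

Definition stage_gen (s : T -> B) t : set B :=
  [set x | range q x \/ exists2 t', lt t' t & b `&` s t' = x].

Definition stage (s : T -> B) t : set B := cm b (stage_gen s t).

Lemma stage_gen_le (s : T -> B) t :
  stage_gen s t `<=` [set x | x <= b].
Proof. by move=> x [[i _ <-]|[t' _ <-]]; [exact: qb|exact: leIl]. Qed.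

(** Before [t] only [Q + seg lt t] many generators are present, which is weak; so Vladimirov's lemma
    supplies the next term. *)
Lemma splitting_sequence : exists s : T -> B, forall t x,
  stage s t x -> x != \bot -> x `&` s t != \bot /\ x `&` ~` s t != \bot.
Proof.
have [wf tr tri] := wlt.
pose gen t (rec : forall t', lt t' t -> B) : set B :=
  [set x | range q x \/ exists t' (h : lt t' t), x = b `&` rec t' h].
have [s sP] := wf_rec_choice \bot
  (fun t rec u => forall x, cm b (gen t rec) x -> x != \bot ->
  x `&` u != \bot /\ x `&` ~` u != \bot) wf.
exists s => t x sx x0.
have genE : gen t (fun t' _ => s t') = stage_gen s t.
  apply/seteqP; split=> y [qy|]; [by left| |by left|].
    by move=> [t' [h ->]]; right; exists t'.
  by move=> [t' h <-]; right; exists t', h.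
apply: (sP t) => //; last by rewrite genE.
have vb : forall z : Q + seg lt t,
  (match z with inl i => q i | inr t' => b `&` s (sval t') end) <= b.
  by case=> [i|t']; [exact: qb|exact: leIl].
have vE : range (fun z : Q + seg lt t => match z with inl i => q i | inr t' =>
  b `&` s (sval t') end) =
    gen t (fun t' _ => s t').
  rewrite genE; apply/seteqP; split=> y.
    by move=> [[i|[t' h]] _ <-]; [left; exists i|right; exists t'].
  by move=> [[i _ <-]|[t' h <-]]; [exists (inl i)|exists (inr (exist _ t' h))].
have := weak_nowhere (Tweak t) vb; rewrite vE => now.
have gb : gen t (fun t' _ => s t') `<=` [set x | x <= b] by rewrite genE;
  exact: stage_gen_le.
have [u _ uP] := vladimirov (cm_closed gb) now.
by exists u.
Qed.

(** Induction on the greatest index [m] among the literals. The element realizing the earlier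
    literals belongs to the stage of [m], so it meets both [s m] and its complement; the new meet
    belongs to all later stages. *)
Lemma splitting_indep (s : T -> B) :
  (forall t x, stage s t x -> x != \bot -> x `&` s t != \bot /\ x `&` ~` s t != \bot)
    ->
  forall e, cm b (range q) e -> e != \bot -> indep e s.
Proof.
move=> sP e qe e0; have [wf tr tri] := wlt.
have stage_e t x : cm b (range q) x -> stage s t x by apply: cm_mono => y; left.
have stage_le t t' x : lt t t' -> stage s t x -> stage s t' x.
  move=> tt'; apply: cm_mono => y [qy|[t1 h <-]]; [by left|right].
  by exists t1 => //; exact: tr h tt'.
suff H m l : consistent l -> (forall i t, List.In (i, t) l -> lt i m \/ i = m) ->
    exists e', [/\ e' != \bot, e' <= e, forall i t, List.In (i, t) l ->
      e' <= lit (s i) t &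
      forall t, lt m t -> stage s t e'].
  move=> l lc; case: l lc => [|p l] lc; first by exists e; split.
  have [m ml mmax] := @wo_max_In _ lt (map fst (p :: l)) p.1 wlt (or_introl erefl).
  have [|e' [? ? ? _]] := H m (p :: l) lc; last by exists e'.
  by move=> i t il; apply: mmax; exact: (@List.in_map _ _ fst _ (i, t) il).
elim/(well_founded_ind wf): m l => m IH l lc lm.
have [|l' l'P] := @list_rel _ _ (fun (p p' : T * bool) => p = p' /\ p.1 <> m) _ l.
  by move=> p p' p'' [<- _] [].
have l'l i t : List.In (i, t) l' -> List.In (i, t) l /\ i <> m.
  by move=> /l'P[p pl [pe pm]]; subst p.
have [e1 [e10 e1e e1l e1s]] : exists e1, [/\ e1 != \bot, e1 <= e,
    forall i t, List.In (i, t) l' -> e1 <= lit (s i) t & stage s m e1].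
  case: l' l'P l'l => [|p l'] l'P l'l; first by exists e; split=> //; exact: stage_e.
  have [m' m'l mmax] := @wo_max_In _ lt (map fst (p :: l')) p.1 wlt (or_introl erefl).
  have m'm : lt m' m.
    have [[i t] [/= im' itl]] := (@List.in_map_iff _ _ fst (p :: l') m').1 m'l;
      subst i.
    have [/lm il im] := l'l _ _ itl.
    by case: il.
  have [||e' [? ? ? He']] := IH m' m'm (p :: l').
  - by move=> i /l'l[h _] /l'l[h' _]; exact: lc h h'.
  - by move=> i t il; apply: mmax; exact: (@List.in_map _ _ fst _ (i, t) il).
  - by exists e'; split=> //; exact: He'.
have e1b : e1 <= b by have [H _ _] := cm_closed (@stage_gen_le s m); exact: H.
have [s1 s2] := sP m e1 e1s e10.
have fin e2 t0 : e2 <= e1 -> e2 <= lit (s m) t0 ->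
  (forall t, List.In (m, t) l -> t = t0) ->
    forall i t, List.In (i, t) l -> e2 <= lit (s i) t.
  move=> e21 e2m lt0 i t il; have [im|im] := pselect (i = m).
    by subst i; rewrite (lt0 t il).
  by apply: (le_trans e21); apply: e1l; apply/l'P; exists (i, t).
have st t : lt m t -> stage s t e1 /\ stage s t (b `&` s m).
  move=> mt; split; first exact: stage_le mt e1s.
  by apply: cm_gen; right; exists m.
have [mt|mt] := pselect (List.In (m, true) l).
  exists (e1 `&` s m); split=> //.
  - by rewrite leIxl.
  - apply: (fin _ true); [exact: leIl|exact: leIr|].
    by case=> // mf; case: (lc m mt mf).
  - move=> t mlt; have [h1 h2] := st t mlt.
    rewrite -(meet_l e1b) -meetA.
    exact: closed_below_meet (cm_closed (@stage_gen_le s t)) h1 h2.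
exists (e1 `&` ~` s m); split=> //.
- by rewrite leIxl.
- apply: (fin _ false); [exact: leIl|exact: leIr|].
  by case.
- move=> t mlt; have [h1 h2] := st t mlt.
  have scl := cm_closed (@stage_gen_le s t); have [_ AN _] := scl.
  have -> : e1 `&` ~` s m = e1 `&` (b `&` ~` (b `&` s m)).
    by rewrite complI meetUr meetxC join0x meetA (meet_l e1b).
  exact: closed_below_meet scl h1 (AN _ h2).
Qed.

End SplittingSequence.

Lemma nonweak_emb Z G : closed_type G -> emb Z G -> ~ weak Z -> emb (below b) G.
Proof. by move=> Gc ZG nZ; apply: contrapT => nG; apply: nZ; exists G. Qed.

(** The whole ideal of [b] is not weak. A nonweak subset of least cardinality, ordered as an initial
    ordinal, has only weak segments. *)
Lemma minimal_nonweak : exists T : Type, ~ weak T /\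
  exists2 lt : T -> T -> Prop, wo lt & forall t, weak (seg lt t).
Proof.
pose M := below b.
have nM : ~ weak {w : M | True}.
  move=> [G [MG _ nMG]]; apply: nMG; apply: emb_trans MG.
  by exists (fun w => exist (fun _ : M => True) w Logic.I) => w w' [].
have [[W nW] Wmin] := @emb_min {W : set M | ~ weak {w : M | W w}}
  (fun W => {w : M | sval W w})
  (exist _ (fun=> True) nM).
have [lt wlt lti] := wo_initial {w : M | W w}.
exists {w : M | W w}; split=> //; exists lt => // t.
apply: contrapT => nt.
pose V : set M := [set w | exists h : W w, lt (exist _ w h) t].
have Vt : emb {w : M | V w} (seg lt t).
  apply: (@emb_rel _ _ (fun u w => sval u = sval (sval w))).
    by move=> [x [h xt]]; exists (exist _ (exist _ x h) xt).
  by move=> [x hx] [y hy] w /= xw yw; apply: eq_exist; rewrite xw yw.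
have tV : emb (seg lt t) {w : M | V w}.
  apply: (@emb_rel _ _ (fun u w => sval (sval u) = sval w)).
    by move=> [[x h] xt]; exists (exist V x (ex_intro _ h xt)).
  by move=> [[x h] xt] [[y h'] yt] w /= xw yw; apply: eq_exist; apply: eq_exist;
    rewrite xw yw.
have nV : ~ weak {w : M | V w} by move=> /(weak_emb tV).
exact: lti t (emb_trans (Wmin (exist _ V nV)) Vt).
Qed.

Let P a := (seq (L a) * seq (seq bool))%type.

Let P_small a : small b (P a).
Proof.
have s2 : small b bool.
  by apply: small_emb (small_nat bS bN); exists nat_of_bool => -[] [].
by apply: (small_prod bS); apply: (small_seq bS bN) => //; apply: (small_seq bS bN).
Qed.

Lemma emb_Lam_Ext : emb Lam (Ext bool).
Proof.
by exists (fun a => existT (fun a => L a -> bool) a (fun=> true)) => a a' e;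
  exact: existT_inj1 e.
Qed.

Lemma emb_small_Ext W : small b W -> emb W (Ext bool).
Proof.
move=> /Lcof[a Wa]; apply: (emb_trans Wa); apply: (emb_trans (emb_indicator _)).
exact: (@emb_existT Lam (fun a => L a -> bool)).
Qed.

(* If the joint antichains alone are not weak, Hausdorff's construction on them
   is enough.  Otherwise mix along them a splitting sequence [s] of minimal
   nonweak length [T]: the place [F] of the antichain [a] receives the term of
   [s] coded by [a] and the restriction of [g : L a -> T] to [F]. *)
Lemma system_indep : exists x : below b -> B, indep b x.
Proof.
have [dd ddJ] := Ljoint P_small; pose Q := {a & P a}.
have Lam0 : exists a, inhabited (L a).
  by have [a [f _]] := Lcof (small_unit bS bN); exists a; split; exact: f tt.
have E2 := Ext_inf (emb_refl bool).
have E2c : closed_type (Ext bool) by split=> //;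
  exact: (Ext_Ext (emb_refl bool) ELam).
(* [Q] embeds in the closed type [Ext bool]; if it is not weak, the ideal of [b] embeds there as
   well. *)
have [Qw|nQw] := pselect (weak Q); last first.
  have [x xI] := indep_hausdorff Bc ddJ; apply: indep_emb xI.
  apply: (nonweak_emb E2c _ nQw).
  apply: (@emb_trans _ (Lam * Ext bool)).
    by apply: emb_sigT_prod => a; exact: emb_small_Ext.
  apply: (emb_trans (emb_prod emb_Lam_Ext (emb_refl _))).
  exact: emb_square.
have [T [nT [lt wlt segw]]] := minimal_nonweak.
have QT : emb Q T.
  by have [TQ|//] := emb_total T Q; case: nT; exact: weak_emb TQ Qw.
have PQ a : emb (P a) Q by exact: (@emb_existT Lam P).
have Tinf : emb nat T.
  have [a _] := Lam0; apply: (emb_trans _ (emb_trans (PQ a) QT)).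
  by exists (fun n => ([::], nseq n [::])) => n m [] /(congr1 size);
    rewrite !size_nseq.
have LamT : emb Lam T.
  by apply: emb_trans QT; exists (fun a => existT P a ([::], [::])) => a a' e;
    exact: existT_inj1 e.
have T2 : emb bool T.
  by apply: emb_trans Tinf; exists nat_of_bool => -[] [].
have ETc : closed_type (Ext T).
  split; first exact: Ext_inf.
  apply: Ext_Ext => //; apply:
    (@emb_sigT Lam (fun a => L a -> Lam) (fun a => L a -> T)) => a.
  exact: emb_fun.
suff [x xI] : exists x : Ext T -> B, indep b x.
  apply: indep_emb xI; apply: (nonweak_emb ETc _ nT).
  have [a [l0]] := Lam0; exists (fun t => existT (fun a => L a -> T) a (fun=> t)).
  by move=> t t' e; have := congr1 (@^~ l0) (existT_inj e).
have [i iI] : emb (Lam * seq T) T.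
  by apply: (emb_trans (emb_prod LamT (emb_seq Tinf))); exact: emb_square.
pose q (p : Q) := b `&` dd _ (projT2 p).
have qb p : q p <= b by exact: leIl.
have [s sP] := splitting_sequence wlt qb (fun t => weak_sum Qw (segw t)).
have sI := splitting_indep wlt qb sP.
have qcl : closed_below Bc b (cm b (range q)) by apply: cm_closed => _ [p _ <-];
  exact: qb.
(* Finite meets of antichain members lie in the subalgebra from which the splitting sequence starts,
   so the sequence is independent below each nonzero one. *)
have meetq (F : forall a, P a) (l : seq Lam) : exists e, [/\ cm b (range q) e, e <= b,
    forall a, List.In a l -> e <= dd a (F a) &
    forall e', e' <= b -> (forall a, List.In a l -> e' <= dd a (F a)) -> e' <= e].
  elim: l => [|a l [e [eq0 eb el emax]]].
    exists b; split=> //; have [_ AN AS] := qcl.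
    have bE : b `&` ~` bsup Bc set0 = b.
      apply/le_anti/andP; split; first exact: leIl.
      by rewrite lexI lexx lexC; apply: bsup_le.
    by rewrite -[X in cm b _ X]bE; apply: (AN); apply: AS => ? [].
  exists (e `&` q (existT _ a (F a))); split.
  - apply: (closed_below_meet qcl) => //; apply: cm_gen.
    by exists (existT _ a (F a)).
  - by rewrite leIxl.
  - move=> a' [<-|/el h]; last by rewrite leIxl.
    by rewrite leIxr // leIr.
  - move=> e' e'b H; rewrite lexI emax //=; last by move=> a' ?; apply: H; right.
    by rewrite lexI e'b H //; left.
have [dis jnt] := ddJ.
eexists; apply: (@indep_mix _ _ Bc b Lam (fun a => seq (L a)) (fun a => L a -> T)
  (fun a F => dd a (F, [::])) (fun a F g => s (i (a, map g F)))).
  by move=> a F F' FF'; apply: dis => -[].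
move=> l lc.
have [F FP] := @finite_separation Lam L (fun _ _ => T) (map fst l).
have [e0 [qe0 e0b e0l e0max]] :=
  meetq (fun a => (F a, [::])) (map (fun p => projT1 p.1) l).
have e00 : e0 != \bot.
  have [e [en0 eb el]] := jnt (fun a => (F a, [::])) (map (fun p => projT1 p.1) l).
  by apply: contraNneq en0 => e0E; rewrite -lex0 -e0E; exact: e0max.
have inl a g t : List.In (existT (fun a => L a -> T) a g, t) l ->
  List.In (existT _ a g) (map fst l).
  by move=> h; apply/List.in_map_iff; exists (existT _ a g, t).
have [|e [en0 ee0 eP]] := sI e0 qe0 e00
    [seq (i (projT1 p.1, map (projT2 p.1) (F (projT1 p.1))), p.2) | p <- l].
  move=> k /List.in_map_iff[[[a g] t] [[<- /= ->] gl]]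
    /List.in_map_iff[[[a' g'] t'] [[/= gg ->] g'l]].
  have aa' : a' = a by have [] := iI _ _ gg.
  subst a'; have [mgg] := iI _ _ gg.
  have gg' := FP a _ _ (inl _ _ _ g'l) (inl _ _ _ gl) (map_eq_In mgg).
  by subst g'; exact: lc gl g'l.
exists F, e; split=> //; first exact: le_trans ee0 e0b.
move=> a g t gl; split.
  apply: (le_trans ee0); apply: e0l.
  by apply/List.in_map_iff; exists (existT _ a g, t).
by apply: eP; apply/List.in_map_iff; exists (existT _ a g, t).
Qed.

End System.

End Completion.

(** * Independent antichains and the Balcar-Franek theorem *)

Lemma emb_cover W (A A1 A2 : set W) : (forall w, A w -> A1 w \/ A2 w) ->
  emb {w | A w} ({w | A1 w} + {w | A2 w}).
Proof.
move=> AA; apply: (@emb_rel _ _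
  (fun w s => sval w = match s with inl u => sval u | inr u => sval u end)).
  move=> [w Aw] /=; have [h|h] := AA w Aw;
    [by exists (inl (exist A1 w h))|by exists (inr (exist A2 w h))].
by move=> [w h] [w' h'] s /= ws ws'; apply: eq_exist; rewrite ws ws'.
Qed.

Lemma emb_inf_pow W : emb nat (W -> bool) -> emb nat W.
Proof.
move=> powW; apply: contrapT => /inf_finite/(@finite_seqP {classic W})[s sT].
have sW w : List.In w s.
  by apply/(@mem_In {classic W}); have : [set: W] w by []; rewrite sT.
have /(emb_trans powW)/embP/infiniteP : emb (W -> bool) ((size s).-tuple bool).
  exists (fun f : W -> bool => map_tuple f (in_tuple (s : seq W))) =>
    f g /(congr1 (@tval _ _))/= /map_eq_In fg.
  by apply/funext => w; exact: fg.
by apply; exact: finite_finset.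
Qed.

Section BalcarFranek.
Context d (B : ctbDistrLatticeType d) (Bc : complete_lattice B).
Implicit Types (x y b c : B).

(** * Antichain cardinalities without a maximum *)

Section Limit.
Variables (b : B) (bS : stable b).
Hypothesis bN : atomless b.
Hypothesis limit : forall W, small b W -> exists2 W', small b W' & ~ emb W' W.

(* Balcar and Vojtas: split each [a i] into more than [|I|] pieces [E i]; treat
   [a j] at the first [i] such that [a j] meets many pieces of [E i], and choose
   distinct such pieces missing every [a k] that meets only few pieces of
   [E i]. *)
Lemma disjoint_refinement I (a : I -> B) : small b I ->
  (forall i, a i != \bot) -> (forall i, a i <= b) ->
  exists r : I -> B, [/\ forall i, r i != \bot, forall i, r i <= a i &
    pairwise_disj r].
Proof.
(* [K] is small, receives [I], and is infinite even for empty [I]; [limit] gives pieces more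
   numerous than [K]. *)
move=> Is a0 ab; pose K := seq (option I).
have Kinf : emb nat K.
  by exists (fun n => nseq n None) => n m /(congr1 size); rewrite !size_nseq.
have IK : emb I K by exists (fun i => [:: Some i]) => i j [].
have [W Ws WK] := limit (small_seq bS bN (small_option bS bN Is)).
pose E i := sval (cid ((bS.2 _ (a0 i) (ab i)).2 W Ws)).
have EA i : antichain (a i) (E i) := svalP (cid ((bS.2 _ (a0 i) (ab i)).2 W Ws)).
pose N i j : set W := [set w | E i w `&` a j != \bot].
pose big i j := ~ emb {w | N i j w} K.
have big_refl i : big i i.
  move=> NK; apply: WK; apply: emb_trans NK; have [E0 Ea _] := EA i.
  have Nii w : N i i w by rewrite /N /= meet_l.
  by exists (fun w => exist _ w (Nii w)) => w w' [].
have [lt wlt] := wo_exists I; have [wf tr tri] := wlt.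
have /choice[sg sgP] j : exists i, big i j /\ forall i', lt i' i -> ~ big i' j.
  by have [i ib imin] := @wo_min _ lt [set i | big i j] j wf (big_refl j); exists i.
(* The pieces of [E i] to be avoided: at most [K] many for each of at most [K] many indices. *)
pose U i : set W := [set w | exists2 k, ~ big i k & N i k w].
have UK i : emb {w | U i w} K.
  apply: (emb_trans _ (emb_square Kinf)).
  apply: (@emb_trans _ ({k | ~ big i k} * K)); last first.
    by apply: emb_prod (emb_refl _); exact: emb_trans (emb_sig _) IK.
  apply: (@emb_trans _ {k : {k | ~ big i k} & {w | N i (sval k) w}}).
    apply: (@emb_rel _ _ (fun w p => sval w = sval (projT2 p))).
      move=> [w [k nk Nw]].
      by exists (existT (fun k : {k | ~ big i k} => {w | N i (sval k) w})
        (exist _ k nk) (exist _ w Nw)).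
    by move=> [w h] [w' h'] p /= ww ww'; apply: eq_exist; rewrite ww ww'.
  by apply: emb_sigT_prod => -[k nk] /=; exact: contrapT.
have [|w wI wN] := @emb_select I W (fun j => N (sg j) j `\` U (sg j))%classic lt wlt.
  move=> j Nj; apply: (sgP j).1.
  apply: (emb_trans (@emb_cover _ _ (N (sg j) j `\` U (sg j))%classic (U (sg j)) _)).
    by move=> w Nw; have [|] := pselect (U (sg j) w); [right|left].
  apply: emb_sum => //; apply: (emb_trans Nj).
  exact: emb_trans (emb_sig _) IK.
exists (fun j => E (sg j) (w j) `&` a j); split.
- by move=> j; have [] := wN j.
- by move=> j; exact: leIr.
have key j j' : lt (sg j) (sg j') -> E (sg j) (w j) `&` a j' = \bot.
  move=> jj'; apply/eqP; apply: contrapT => /negP h; have [_] := wN j; apply.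
  by exists j' => //; exact: (sgP j').2.
move=> j j' jj'; have [ss|ss|ss] := tri (sg j) (sg j').
- apply: (le_disj_bot _ _ (key _ _ ss)); first by rewrite leIxl // leIl.
  by rewrite leIxr // leIr.
- have [_ _ Ed] := EA (sg j).
  have ww : w j <> w j' by move=> /wI.
  apply: (le_disj_bot _ _ (Ed _ _ ww)); first by rewrite leIxl // leIl.
  by rewrite ss leIxr // leIl.
- apply: (le_disj_bot _ _ (key _ _ ss)); first by rewrite leIxr // leIl.
  by rewrite leIxl // leIr.
Qed.

Variables (lt : B -> B -> Prop).
Hypothesis wlt : wo lt.

Let Lam := {x : B | small b (seg lt x)}.
Let L (a : Lam) := seg lt (sval a).
Let ltL (a a' : Lam) := lt (sval a) (sval a').

(** [B] is larger than [W], so [W] embeds in some segment; the least such segment embeds back in [W]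
    and is therefore small. *)
Lemma limit_cof W : small b W -> exists a, emb W (L a).
Proof.
move=> Ws; have [wf tr tri] := wlt.
have [[x Wx]|BW] := wo_compare W wlt; last first.
  by case: (small_nle Bc bS bN Ws); exact: emb_trans (emb_sig _) BW.
have [m Wm mmin] := @wo_min _ lt [set x | emb W (seg lt x)] x wf Wx.
have [[y Wy]|mW] := wo_compare W (wo_sig (fun x => lt x m) wlt).
  case: (mmin (sval y) (svalP y)); apply: (emb_trans Wy).
  exact: emb_seg_sig.
by exists (exist _ m (small_emb mW Ws)).
Qed.

Let L_strict W : small b W -> exists a, emb W (L a) /\ ~ emb (L a) W.
Proof.
move=> Ws; have [W' W's W'W] := limit Ws; have [a W'a] := limit_cof W's.
have aW : ~ emb (L a) W by move=> /(emb_trans W'a).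
by exists a; split=> //; have [|/aW] := emb_total W (L a).
Qed.

(* A map from a small type to [Lam] is bounded, so it is coded by a subset of
   a small type. *)
Lemma limit_Ext : emb (Ext L Lam) (Ext L bool).
Proof.
have [wf tr tri] := wlt.
have Ei : emb nat (Ext L bool) := Ext_inf bS bN limit_cof (emb_refl bool).
pose G (p : Lam * Lam) := (L p.1 * L p.2)%type -> bool.
apply: (@emb_trans _ {p & G p}); last first.
  apply: (@emb_trans _ ((Lam * Lam) * Ext L bool)).
    apply: emb_sigT_prod => -[a c].
    have [e ace] := limit_cof (small_prod bS (svalP a) (svalP c)).
    exact: (emb_trans (emb_dom true ace) (@emb_existT Lam (fun a => L a -> bool) e)).
  have LE := emb_Lam_Ext L.
  apply: (emb_trans _ (emb_square Ei)); apply: emb_prod (emb_refl _).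
  exact: (emb_trans (emb_prod LE LE) (emb_square Ei)).
(* The graph of the map, once its values lie below [c]. Such a [c] exists because some [L c] does
   not embed in the disjoint union of the segments of the values. *)
pose code (q : Ext L Lam) (c : Lam) : G (projT1 q, c) := fun p =>
  `[< sval (projT2 q p.1) = sval p.2 >].
apply: (@emb_rel _ _ (fun (q : Ext L Lam) (w : {p & G p}) =>
  exists2 c : Lam, (forall l, ltL (projT2 q l) c) &
  w = existT G (projT1 q, c) (code q c))).
  move=> [a f] /=.
  have [c [_ nc]] := L_strict (small_sigT bS (svalP a) (fun l : L a => svalP (f l))).
  exists (existT G (a, c) (code (existT _ a f) c)); exists c => // l; rewrite /ltL.
  have Lfl : emb (L (f l)) {l : L a & L (f l)} :=
    @emb_existT (L a) (fun l => L (f l)) l.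
  have [//|fc|cf] := tri (sval (f l)) (sval c).
    by case: nc; rewrite /L -fc.
  case: nc; apply: emb_trans Lfl;
    apply: (@emb_sub B (fun x => lt x (sval c)) (fun x => lt x (sval (f l)))).
  by move=> x xc; exact: tr xc cf.
move=> [a f] [a' f'] w [c cf ->] [c' cf' e].
have [aa' cc'] : (a, c) = (a', c') := existT_inj1 e; subst a' c'.
have ff := existT_inj e; congr existT; apply/funext => l.
have := congr1 (@^~ (l, exist _ (sval (f l)) (cf l))) ff; rewrite /code /= => h.
have : sval (f' l) = sval (f l) by apply/asboolP; rewrite -h; exact/asboolP.
by case: (f l) (f' l) => u hu [v hv] /= vu; exact: eq_exist.
Qed.

(* Every member of the antichain [dd a] meets all nonzero finite meets of members
   of the earlier antichains: split a disjoint refinement of these meets. *)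
Lemma limit_joint (P : Lam -> Type) : (forall a, small b (P a)) ->
  exists dd : forall a, P a -> B, joint_antichains b dd.
Proof.
move=> Ps; have wltL : wo ltL := wo_sig _ wlt; have [wf tr tri] := wltL.
(* The recursion needs one value type for all [a], so each antichain is a function on [D], of which
   only the part over [a] matters. *)
pose D := {a & P a}.
pose mt a (rec : forall a', ltL a' a -> D -> B)
  (l : seq {a' : seg ltL a & P (sval a')}) :=
  foldr (fun p acc => rec _ (svalP (projT1 p)) (existT P _ (projT2 p)) `&` acc) b l.
have [f fP] := wf_rec_choice (fun _ : D => \bot : B) (fun a rec (d : D -> B) =>
  pairwise_disj (fun p => d (existT P a p)) /\
  forall l, mt a rec l != \bot -> forall p, mt a rec l `&` d (existT P a p) != \bot)
    wf.
pose m a := mt a (fun a' _ => f a').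
have mb a l : m a l <= b by elim: l => [|p l IH] /=; [exact: lexx|rewrite leIxr].
have {}fP a : pairwise_disj (fun p => f a (existT P a p)) /\
    forall l, m a l != \bot -> forall p, m a l `&` f a (existT P a p) != \bot.
  apply: fP; pose J := {l | m a l != \bot}.
  have Js : small b J.
    apply: small_emb (emb_sig _) _; apply: (small_seq bS bN).
    apply: (small_sigT bS) => [|a']; last exact: Ps.
    exact: small_emb (emb_seg_sig lt a) (svalP a).
  have [r [r0 rm rd]] := disjoint_refinement Js (fun j : J => svalP j)
    (fun j : J => mb a (sval j)).
  have rb j : r j <= b := le_trans (rm j) (mb a (sval j)).
  pose h j := sval (cid ((bS.2 _ (r0 j) (rb j)).2 (P a) (Ps a))).
  have hA j : antichain (r j) (h j) :=
    svalP (cid ((bS.2 _ (r0 j) (rb j)).2 (P a) (Ps a))).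
  (* Each [r j] is cut into pieces labelled by [P a]; the pieces with the same label are joined over
     all [j]. *)
  exists (fun q : D => bsup Bc [set y | exists p j, q = existT P a p /\ y = h j p]);
    split.
    move=> p p' pp'; rewrite meetC; apply: bsup_meet0 => y [p1 [j [e ->]]];
      have pE := existT_inj e; subst p1.
    rewrite meetC; apply: bsup_meet0 => y' [p1 [j' [e' ->]]];
      have pE := existT_inj e'; subst p1.
    have [_ hj _] := hA j; have [_ hj' hd'] := hA j'.
    have [jj'|/rd jj'] := pselect (j = j'); first by subst j'; exact: hd'.
    exact: le_disj_bot (leIxl _ (hj p)) (leIxr _ (hj' p')) jj'.
  move=> l l0 p; pose j : J := exist _ l l0.
  have [h0 hj _] := hA j.
  apply: contraNneq (h0 p) => mh; rewrite -lex0 -mh lexI (le_trans (hj p) (rm j)) /=.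
  by apply: bsup_ub; exists p, j.
exists (fun a p => f a (existT P a p)); split=> [a|F l]; first exact: (fP a).1.
pose M (l : seq Lam) := foldr (fun a acc => f a (existT P a (F a)) `&` acc) b l.
have Mb l0 : M l0 <= b by elim: l0 => [|a l0 IH] /=; [exact: lexx|rewrite leIxr].
have Ml l0 a : List.In a l0 -> M l0 <= f a (existT P a (F a)).
  by elim: l0 => //= a' l0 IH [<-|/IH h]; [exact: leIl|rewrite leIxr].
have leM e l0 : e <= b -> (forall a, List.In a l0 -> e <= f a (existT P a (F a))) ->
  e <= M l0.
  move=> eb; elim: l0 => //= a l0 IH H; rewrite lexI H ?IH //; last by left.
  by move=> a' ?; apply: H; right.
suff M0 l0 : M l0 != \bot by exists (M l); split=> // a; exact: Ml.
suff H k : forall l0, (forall a, List.In a l0 -> ltL a k \/ a = k) -> M l0 != \bot.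
  case: l0 => [|a l3]; first exact: bS.1.
  have [k _ kmax] := @wo_max_In _ ltL (a :: l3) a wltL (or_introl erefl).
  exact: H kmax.
elim/(well_founded_ind wf): k => k IH l3 l0k.
have [|l1 l1P] := @list_rel _ _ (fun a a' : Lam => a = a' /\ a <> k) _ l3.
  by move=> a a' a'' [<- _] [].
have l1k a : List.In a l1 -> ltL a k.
  by move=> /l1P[a' /l0k[h|h] [aa' nk]]; subst a'.
have M1 : M l1 != \bot.
  case: l1 l1k {l1P} => [|a l1] l1k; first exact: bS.1.
  have [k' k'l kmax] := @wo_max_In _ ltL (a :: l1) a wltL (or_introl erefl).
  exact: IH (l1k _ k'l) _ kmax.
have [l2 l2E] : exists l2, m k l2 = M l1.
  elim: l1 l1k {l1P M1} => [|a l1 IH1] l1k; first by exists [::].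
  have [|l2 l2E] := IH1; first by move=> a' ?; apply: l1k; right.
  exists (existT (fun a' : seg ltL k => P (sval a'))
    (exist _ a (l1k a (or_introl erefl))) (F a) :: l2).
  by rewrite /= -l2E.
have := (fP k).2 l2; rewrite l2E => /(_ M1 (F k)).
apply: contraNneq => M00; rewrite -lex0 -M00; apply: leM; first by rewrite leIxl.
move=> a al; have [->|ak] := pselect (a = k); first exact: leIr.
by rewrite leIxl // Ml //; apply/l1P; exists a.
Qed.

End Limit.

Lemma stable_indep b : stable b ->
  (exists c, [/\ c <= b, c != \bot & c != b]) -> exists x : below b -> B, indep b x.
Proof.
move=> bS bna; have bN := stable_atomless bS bna.
have [[L0 [Ls Lmax]]|lim] :=
  pselect (exists L0, small b L0 /\ forall W, small b W -> emb W L0).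
  apply: (@system_indep _ _ Bc b bS bN unit (fun=> L0)) => //.
  - by move=> W /Lmax ?; exists tt.
  - apply: (@emb_sigT unit (fun=> L0 -> unit) (fun=> L0 -> bool)) => _.
    by apply: emb_fun; exists (fun=> true) => -[] [].
  - move=> P /(_ tt)[g [g0 gb gd]]; exists (fun a => match a with tt => g end).
    split=> [[]//|F l]; exists (g (F tt)); split=> //.
    by case.
have limit W : small b W -> exists2 W', small b W' & ~ emb W' W.
  move=> Ws; apply: contrapT => nW; apply: lim; exists W; split=> // W' W's.
  by apply: contrapT => W'W; apply: nW; exists W'.
have [lt wlt] := wo_exists B.
apply: (@system_indep _ _ Bc b bS bN {x : B | small b (seg lt x)}
  (fun a => seg lt (sval a))).
- by move=> [x xs].
- exact: limit_cof.
- exact: limit_Ext.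
- exact: limit_joint.
Qed.

Theorem balcar_franek : infinite_set [set: B] -> exists x : B -> B, indep \top x.
Proof.
move=> /infiniteP/embP Binf.
have := @max_disjoint _ B (@stable _ B).
move=> [D [DS D0 Dd Dmax]].
have dense (x : B) : x != \bot -> exists b c, [/\ D b, c <= x, c <= b & c != \bot].
  move=> /stable_dense[c cS cx]; have [b Db bc] := Dmax c cS cS.1.
  by exists b, (b `&` c); split=> //; [rewrite leIxr|exact: leIl].
pose atomic b := forall c, c <= b -> c = \bot \/ c = b.
pose At : set B := [set b | D b /\ atomic b].
pose N : set B := [set b | D b /\ ~ atomic b].
pose tr (x b : B) : below b := exist (fun c => c <= b) (b `&` x) (leIl _ _).
(* By density of stable elements, an element is determined by its traces on [D]. One of the two
   partial products is then already as large as [B]. *)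
have : emb B ((forall b : {b | At b}, below (sval b)) *
  (forall b : {b | N b}, below (sval b))).
  exists (fun x => (fun p => tr x (sval p), fun p => tr x (sval p))) => x y [xyA xyN].
  have xy b : D b -> b `&` x = b `&` y.
    move=> Db; have [bA|bN] := pselect (atomic b).
      exact: (congr1 (fun h => sval (h (exist At b (conj Db bA)))) xyA).
    exact: (congr1 (fun h => sval (h (exist N b (conj Db bN)))) xyN).
  have le_of x' y' : (forall b, D b -> b `&` x' = b `&` y') -> x' <= y'.
    move=> xy'; apply: contrapT => /negP/nle_meetC/dense[b [c [Db]]].
    rewrite lexI => /andP[cx cy] cb; apply/negP;
      rewrite negbK -lex0 -(meetxC y') lexI cy andbT.
    by rewrite (@le_trans _ _ (b `&` x')) ?lexI ?cb // xy' // leIr.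
  by apply/le_anti/andP; split; apply: le_of => b /xy.
move=> /(emb_prod_or Binf)[BA|BN]; last first.
  apply: (indep_glue Bc Binf _ _ BN).
    move=> [x [Dx nx]] [y [Dy ny]] xy; apply: Dd => //= xy'; apply: xy.
    exact: eq_exist.
  move=> n [Dn nn]; have nS := DS _ Dn.
  have nna : exists c, [/\ c <= n, c != \bot & c != n].
    apply: contrapT => H; apply: nn => c cn; have [->|c0] := eqVneq c \bot;
      first by left.
    by right; apply/eqP; apply: contrapT => /negP cn'; apply: H; exists c.
  split; last exact: stable_indep.
  exact: below_inf nS (stable_atomless nS nna).
have BA2 : emb B ({b | At b} -> bool).
  apply: (emb_trans BA).
  exists (fun f p => sval (f p) == \bot) => f g fg;
    apply/functional_extensionality_dep => -[b [Db bA]].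
  have := congr1 (@^~ (exist At b (conj Db bA))) fg => /=.
  case: (f _) (g _) => x xb [y yb] /= xy; apply: eq_exist.
  have b0 := D0 _ Db.
  case: (bA _ xb) (bA _ yb) xy => -> [] -> //; rewrite eqxx.
    by move=> /esym/eqP bE; move: b0; rewrite bE eqxx.
  by move=> /eqP bE; move: b0; rewrite bE eqxx.
have Ainf : emb nat {b | At b} := emb_inf_pow (emb_trans Binf BA2).
(* The infinitely many atoms in [D] are disjoint, so relabelled they serve as the places of
   Hausdorff's construction. *)
have [i iI] : emb (seq {b | At b} * seq (seq bool)) {b | At b}.
  apply: emb_trans (emb_square Ainf); apply: emb_prod (emb_seq Ainf) _.
  apply: emb_trans Ainf; exists choice.pickle; exact: pcan_inj choice.pickleK.
have [|x xI] := @indep_hausdorff _ B Bc \top unit (fun=> {b | At b})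
  (fun _ p => sval (i p)).
  split=> [_ p q pq|F l].
    have : i p <> i q by move=> /iI.
    case: (i p) (i q) => x [Dx ?] [y [Dy ?]] xy; apply: Dd => //= xy'; apply: xy.
    exact: eq_exist.
  exists (sval (i (F tt))); split=> [|//|[]//]; exact: D0 (svalP (i (F tt))).1.
apply: indep_emb xI; apply: (emb_trans BA2).
exact: (@emb_existT unit (fun=> {b | At b} -> bool) tt).
Qed.

End BalcarFranek.

(* The cardinal |B| is represented by an arbitrary type K equipotent to B. *)
Theorem theorem2p2 (d : Order.disp_t) (B : ctbDistrLatticeType d)
    (Bcomplete : complete_lattice B) (Binfinite : infinite_set [set: B]) :
  exists U : ultrafilter B, forall K : choiceType, [set: K] #= [set: B] ->
    tukey_equiv (uf_ge U) (finite_subsets K).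
Proof.
have [x xI] := balcar_franek Bcomplete Binfinite.
exact: tukey_top_of_indep xI.
Qed.
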